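(* Let $p,k\ge 1$ be integers, and let $\alpha_1,\dots,\alpha_{k+1},\gamma_1,\dots,\gamma_k\in\mathbb{C}$ satisfy $\Re(\alpha_j)>p-1$ for $j=1,\dots,k+1$ and $\Re(\alpha_j+\gamma_j)>p-1$ for $j=1,\dots,k$. Let $E[\cdot]$ denote the average over the $p\times p$ complex matrix-variate type-1 Dirichlet measure with parameters $(\alpha_1,\dots,\alpha_k;\alpha_{k+1})$, and let $$\phi_1(\tilde X_1,\dots,\tilde X_k)=|\det(\tilde X_1)|^{\gamma_1}\cdots|\det(\tilde X_k)|^{\gamma_k}.$$ Then $$E[\phi_1]=\left\{\prod_{j=1}^k\frac{\tilde\Gamma_p(\alpha_j+\gamma_j)}{\tilde\Gamma_p(\alpha_j)}\right\}\frac{\tilde\Gamma_p(\alpha_1+\cdots+\alpha_{k+1})}{\tilde\Gamma_p(\alpha_1+\gamma_1+\cdots+\alpha_k+\gamma_k+\alpha_{k+1})}.$$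
   Context: For Hermitian matrices, $A>O$ means $A$ is positive definite, and $A>B$ means $A-B>O$; $I$ is the $p\times p$ identity. For a $p\times p$ Hermitian matrix variable $\tilde X=(x_{ij}+\mathrm{i}\,y_{ij})$, $d\tilde X=\prod_{i\le j}dx_{ij}\prod_{i<j}dy_{ij}$ (Lebesgue measure in the independent real coordinates). $|\det(\cdot)|$ is the absolute value of the determinant. The complex matrix-variate gamma function is $\tilde\Gamma_p(\alpha)=\pi^{p(p-1)/2}\,\Gamma(\alpha)\Gamma(\alpha-1)\cdots\Gamma(\alpha-(p-1))$ for $\Re(\alpha)>p-1$. The complex matrix-variate type-1 Dirichlet measure with parameters $(\alpha_1,\dots,\alpha_k;\alpha_{k+1})$, $\Re(\alpha_j)>p-1$, has density $$f_1(\tilde X_1,\dots,\tilde X_k)=\tilde D_k\left(\prod_{j=1}^k|\det(\tilde X_j)|^{\alpha_j-p}\right)|\det(I-\tilde X_1-\cdots-\tilde X_k)|^{\alpha_{k+1}-p},\qquad \tilde D_k=\frac{\tilde\Gamma_p(\alpha_1+\cdots+\alpha_{k+1})}{\tilde\Gamma_p(\alpha_1)\cdots\tilde\Gamma_p(\alpha_{k+1})},$$ on the set of $k$-tuples of $p\times p$ Hermitian matrices with $\tilde X_j>O$, $I-\tilde X_j>O$ for all $j$, and $I-(\tilde X_1+\cdots+\tilde X_k)>O$; it is zero elsewhere. The Dirichlet average of a function $\phi$ is $E[\phi]=\int \phi\, f_1\,d\tilde X_1\cdots d\tilde X_k$. *)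

(* Defs.v *)
From HB Require Import structures.
From mathcomp Require Import all_boot all_order all_algebra.
From mathcomp Require Import sesquilinear complex.
From mathcomp Require Import all_classical all_reals all_analysis.

Set Implicit Arguments.
Unset Strict Implicit.
Unset Printing Implicit Defensive.

Import Order.TTheory GRing.Theory Num.Theory.
Import numFieldNormedType.Exports.

Local Open Scope classical_set_scope.
Local Open Scope ring_scope.
Local Open Scope complex_scope.

(* Product of n copies of a sigma-finite measure m, on n.-tuple T: the
   recursion transports m \x m^n along (x, t) |-> x :: t, and
   tuple_measureE shows that m^n (A_0 x ... x A_(n-1)) = \prod_i m (A_i). *)
Section tuple_measure.
Context d (T : measurableType d) (R : realType).
Variable m : {sigma_finite_measure set T -> \bar R}.

Definition cons_pair n (x : T * n.-tuple T) : n.+1.-tuple T :=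
  [tuple of x.1 :: x.2].

Definition uncons_tuple n (t : n.+1.-tuple T) : T * n.-tuple T :=
  (thead t, [tuple of behead t]).

Lemma cons_pairK n : cancel (@cons_pair n) (@uncons_tuple n).
Proof. by case=> x t; congr pair; apply: val_inj. Qed.

Lemma measurable_cons_pair n : measurable_fun setT (@cons_pair n).
Proof. exact: measurable_cons. Qed.

Lemma measurable_uncons_tuple n : measurable_fun setT (@uncons_tuple n).
Proof.
by apply/measurable_fun_pair; [exact: measurable_tnth|exact: measurable_behead].
Qed.

Section cons_measure.
Variables (n : nat) (mu : {sigma_finite_measure set (n.-tuple T) -> \bar R}).

Definition cons_measure : set (n.+1.-tuple T) -> \bar R :=
  pushforward (m \x mu)%E (@cons_pair n).

Let cons_measure0 : cons_measure set0 = 0%E.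
Proof. by rewrite /cons_measure /pushforward preimage_set0 measure0. Qed.

Let cons_measure_ge0 A : (0 <= cons_measure A)%E.
Proof. exact: (measure_ge0 (m \x mu)%E). Qed.

Let cons_measure_sigma_additive : semi_sigma_additive cons_measure.
Proof.
exact: (@measure_semi_sigma_additive _ _ _
  (measure_function_pushforward__canonical__measure_function_Measure
    (m \x mu)%E (@measurable_cons_pair n))).
Qed.

HB.instance Definition _ := isMeasure.Build _ _ _ cons_measure
  cons_measure0 cons_measure_ge0 cons_measure_sigma_additive.

Let cons_measure_sigma_finite : sigma_finite setT cons_measure.
Proof.
have /sigma_finiteP[F [TF ndF Foo]] := sigma_finiteT m.
have /sigma_finiteP[G [TG ndG Goo]] := sigma_finiteT mu.
exists (fun i => @uncons_tuple n @^-1` (F i `*` G i)).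
  rewrite -preimage_bigcup (_ : \bigcup_i _ = setT) ?preimage_setT//.
  apply/seteqP; split => // -[x y] _.
  have [i _ Fix] : (\bigcup_i F i) x by rewrite -TF.
  have [j _ Gjy] : (\bigcup_i G i) y by rewrite -TG.
  exists (maxn i j) => //; split => /=.
    by move: x Fix; exact/subsetPset/ndF/leq_maxl.
  by move: y Gjy; exact/subsetPset/ndG/leq_maxr.
move=> i; have [mF mFoo] := Foo i; have [mG muGoo] := Goo i; split.
  rewrite -[X in measurable X]setTI; apply: measurable_uncons_tuple => //.
  exact: measurableX.
rewrite /cons_measure /pushforward -comp_preimage (_ : _ \o _ = id); last first.
  by apply/funext => x /=; rewrite cons_pairK.
by rewrite product_measure1E// lte_mul_pinfty// ge0_fin_numE.
Qed.

HB.instance Definition _ := Measure_isSigmaFinite.Build _ _ _ cons_measure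
  cons_measure_sigma_finite.

End cons_measure.

Fixpoint tuple_measure n : {sigma_finite_measure set (n.-tuple T) -> \bar R} :=
  match n with
  | 0 => \d_([tuple] : 0.-tuple T)
  | n'.+1 => cons_measure (tuple_measure n')
  end.

Lemma tuple_measureE n (A : 'I_n -> set T) : (forall i, measurable (A i)) ->
  tuple_measure n [set t | forall i, A i (tnth t i)] = (\prod_i m (A i))%E.
Proof.
elim: n A => [|n ih] A mA.
  by rewrite big_ord0 /= diracE mem_set// => -[].
rewrite big_ord_recl -(ih (fun i => A (lift ord0 i)))//.
rewrite -product_measure1E//=; last first.
  rewrite [X in measurable X](_ : _ =
    \bigcap_(i in [set: 'I_n]) ((@tnth n T ^~ i) @^-1` A (lift ord0 i))).
    apply: fin_bigcap_measurable => // i _.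
    by rewrite -[X in measurable X]setTI; exact: measurable_tnth.
  by apply/seteqP; split => [t At i _|t At i]; exact: At.
congr product_measure1; apply/seteqP; split => -[x t] /=.
  move=> At; split; first exact: (At ord0).
  by move=> i; have := At (lift ord0 i); rewrite tnthS.
move=> [Ax At] i; have [j ->|->] := unliftP ord0 i.
  by rewrite tnthS.
exact: Ax.
Qed.

End tuple_measure.

Section complex_valued.
Variable R : realType.
Local Notation C := R[i].

Section cintegral.
Context d (T : measurableType d) (mu : {measure set T -> \bar R}).
Variables (D : set T) (f : T -> C).

Definition cintegrable :=
  mu.-integrable D (fun x => (complex.Re (f x))%:E) /\
  mu.-integrable D (fun x => (complex.Im (f x))%:E).

Definition cintegral : C :=
  (\int[mu]_(x in D) complex.Re (f x)) +i* (\int[mu]_(x in D) complex.Im (f x)).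

End cintegral.

Definition expC (z : C) : C :=
  (expR (complex.Re z) * cos (complex.Im z)) +i* (expR (complex.Re z) * sin (complex.Im z)).

(* t ^ z = exp (z ln t) for t > 0; the value 1 taken for t <= 0 (where the
   library sets ln t = 0) is immaterial: below, t > 0 wherever the density does
   not vanish. *)
Definition rpowC (t : R) (z : C) : C := expC (z * (ln t)%:C).

(* Euler's integral, meaningful for 0 < Re z. *)
Definition gammaC (z : C) : C :=
  cintegral (@lebesgue_measure R) `]0, +oo[
    (fun t => rpowC t (z - 1) * (expR (- t))%:C).

Definition mxgamma (p : nat) (z : C) : C :=
  (pi ^+ (p * p.-1)./2)%:C * \prod_(i < p) gammaC (z - i%:R).

Definition posdefmx (p : nat) (A : 'M[C]_p) : Prop :=
  A \is hermsymmx /\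
  forall v : 'rV[C]_p, v != 0 -> 0 < (v *m A *m map_mx Num.conj v^T) 0 0.

Definition absdet (p : nat) (A : 'M[C]_p) : R := Normc.normc (\det A).

(* The p ^ 2 independent real coordinates of a Hermitian matrix X = x + i y,
   arranged in a p x p array c: c_ij = x_ij for i <= j, and c_ji = y_ij for
   i < j. *)
Definition hermcoord (p : nat) := p.-tuple (p.-tuple (measurableTypeR R)).

Definition hermmx_of (p : nat) (c : hermcoord p) : 'M[C]_p :=
  \matrix_(i, j)
    let c_ (i j : 'I_p) : R := tnth (tnth c i) j in
    if i == j then (c_ i i)%:C
    else if (i < j)%N then c_ i j +i* c_ j i
    else c_ j i -i* c_ i j.

(* dX_1 ... dX_k in these coordinates *)
Definition hermcoord_measure (p k : nat) :
    {sigma_finite_measure set (k.-tuple (hermcoord p)) -> \bar R} :=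
  tuple_measure (tuple_measure (tuple_measure (@lebesgue_measure R) p) p) k.

Section dirichlet.
Variables (p k : nat).
Implicit Types (alpha : 'I_k.+1 -> C) (X : 'I_k -> 'M[C]_p).

Definition dirichlet_domain X : Prop :=
  [/\ forall j, posdefmx (X j),
      forall j, posdefmx (1%:M - X j) &
      posdefmx (1%:M - \sum_j X j)].

Definition dirichlet_const alpha : C :=
  mxgamma p (\sum_j alpha j) / \prod_j mxgamma p (alpha j).

(* alpha_1, ..., alpha_k are alpha (widen_ord (leqnSn k) j) for j : 'I_k, and
   alpha_(k+1) is alpha ord_max. *)
Definition dirichlet_density alpha X : C :=
  if `[< dirichlet_domain X >] then
    dirichlet_const alpha *
    (\prod_(j < k)
       rpowC (absdet (X j)) (alpha (widen_ord (leqnSn k) j) - p%:R)) *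
    rpowC (absdet (1%:M - \sum_j X j)) (alpha ord_max - p%:R)
  else 0.

Definition dirichlet_integrand alpha (phi : ('I_k -> 'M[C]_p) -> C)
    (c : k.-tuple (hermcoord p)) : C :=
  let X j := hermmx_of (tnth c j) in phi X * dirichlet_density alpha X.

Definition dirichlet_average_exists alpha (phi : ('I_k -> 'M[C]_p) -> C) :=
  cintegrable (hermcoord_measure p k) setT (dirichlet_integrand alpha phi).

Definition dirichlet_average alpha (phi : ('I_k -> 'M[C]_p) -> C) : C :=
  cintegral (hermcoord_measure p k) setT (dirichlet_integrand alpha phi).

End dirichlet.

Definition det_power_product (p k : nat) (gamma : 'I_k -> C)
    (X : 'I_k -> 'M[C]_p) : C :=
  \prod_(j < k) rpowC (absdet (X j)) (gamma j).

End complex_valued.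

(* Main.v *)
Require Import Defs.
From HB Require Import structures.
From mathcomp Require Import all_boot all_order all_algebra.
From mathcomp Require Import sesquilinear complex.
From mathcomp Require Import all_classical all_reals all_analysis.
From mathcomp Require Import measurable_realfun ring lra.

(** Write G_a(X) = |det X|^(a-p) exp(-tr X) for X > 0. Taking the Schur
    complement of the upper left entry, which only uses translations and a
    Gaussian integral, one gets by induction on p that the integral of G_a is
    mxgamma p a. Integrate the product of the G_(a_j)(X_j), j <= k+1, and
    translate to the variable S = X_1 + ... + X_(k+1). For S = L L* with L lower
    triangular, the substitution X_j -> L X_j L*, of Jacobian |det L|^(2p) for
    each j, shows that the integral over X_1, ..., X_k for fixed S is
    G_(a_1+...+a_(k+1))(S) times the Dirichlet integral. Hence the Dirichlet
    integral times mxgamma p (a_1+...+a_(k+1)) is the product of the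
    mxgamma p a_j, and the theorem is a quotient of two such identities.
    Dividing requires that the complex gamma function has no zeros with
    positive real part. *)

Set Implicit Arguments.
Unset Strict Implicit.
Unset Printing Implicit Defensive.

Import Order.TTheory GRing.Theory Num.Theory.
Import numFieldNormedType.Exports.

Local Open Scope classical_set_scope.
Local Open Scope ring_scope.

(** * Change of variables for product measures *)

(** Every substitution is assembled from one-dimensional affine maps by fibering: one coordinate is
    changed by a map that may depend on the others, and the weights multiply. No Jacobian
    determinant of a map in several variables is evaluated, so each map has to be triangular in
    suitable coordinates. This is what asks for a triangular [L]: in the coordinates (corner,
    border, lower block) its congruence changes one coordinate at a time, up to translations by
    functions of the others. The Jacobian is established along the construction of [L], and not for
    a general matrix.

    With complex exponents the densities have no sign, so convergence of the Dirichlet integral is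
    not a by-product of the identity. It follows from the identity for the moduli, by dividing by
    the integral of |G_s|, with s the total parameter; this is positive since the integral of G_s is
    [mxgamma p s]. The absence of zeros of gamma thus already serves here.

    Zeros are excluded in two stages: the functional equation moves a zero to the right along a
    horizontal line, and far enough to the right an elementary estimate rules it out. *)

Section sprod.
Context {R : realType} d1 d2 (T : measurableType d1) (U : measurableType d2).
Variables (mu : {sigma_finite_measure set T -> \bar R})
  (nu : {sigma_finite_measure set U -> \bar R}).
Local Open Scope ereal_scope.

(* The library's product measure under a name of its own, so that the
   sigma-finite structure is found when products are iterated. *)
Definition sprod : set (T * U) -> \bar R := mu \x nu.

Let sprod0 : sprod set0 = 0. Proof. exact: measure0. Qed.

Let sprod_ge0 A : 0 <= sprod A. Proof. exact: measure_ge0. Qed.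

Let sprod_sigma_additive : semi_sigma_additive sprod.
Proof. exact: measure_semi_sigma_additive. Qed.

HB.instance Definition _ := isMeasure.Build _ _ _ sprod
  sprod0 sprod_ge0 sprod_sigma_additive.

Let sprod_sigma_finite : sigma_finite setT sprod.
Proof.
have /sigma_finiteP[F [TF ndF Foo]] := sigma_finiteT mu.
have /sigma_finiteP[G [TG ndG Goo]] := sigma_finiteT nu.
exists (fun n => F n `*` G n).
  rewrite -setXTT TF TG predeqE => -[x y]; split.
    move=> [/= [n _ Fnx] [k _ Gky]]; exists (maxn n k) => //; split.
    - by move: x Fnx; exact/subsetPset/ndF/leq_maxl.
    - by move: y Gky; exact/subsetPset/ndG/leq_maxr.
  by move=> [n _ []/= ? ?]; split; exists n.
move=> k; have [? ?] := Foo k; have [? ?] := Goo k.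
split; first exact: measurableX.
by rewrite /sprod product_measure1E// lte_mul_pinfty// ge0_fin_numE.
Qed.

HB.instance Definition _ := Measure_isSigmaFinite.Build _ _ _ sprod
  sprod_sigma_finite.

Lemma sprod_integral1 f : measurable_fun setT f -> (forall z, 0 <= f z) ->
  \int[sprod]_z f z = \int[mu]_x \int[nu]_y f (x, y).
Proof. exact: fubini_tonelli1. Qed.

Lemma sprod_integral2 f : measurable_fun setT f -> (forall z, 0 <= f z) ->
  \int[sprod]_z f z = \int[nu]_y \int[mu]_x f (x, y).
Proof. exact: fubini_tonelli2. Qed.

End sprod.

Section change_of_variables.
Context {R : realType}.

Section def.
Context d1 d2 (T : measurableType d1) (U : measurableType d2).
Variables (mu : {measure set T -> \bar R}) (nu : {measure set U -> \bar R}).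

(* mu is the image under phi of the measure w . nu; stated through integrals of
   nonnegative functions. *)
Definition cov (phi : U -> T) (w : U -> R) : Prop :=
  [/\ measurable_fun setT phi, measurable_fun setT w, forall u, 0 <= w u &
      forall f : T -> \bar R, measurable_fun setT f -> (forall x, 0 <= f x)%E ->
      (\int[mu]_x f x = \int[nu]_u (f (phi u) * (w u)%:E))%E].

Lemma cov_ext phi w phi' w' : phi =1 phi' -> w =1 w' ->
  cov phi w -> cov phi' w'.
Proof. by move=> /funext<- /funext<-. Qed.

(** Nonnegative weights commute with positive and negative parts, so the formula extends to
    functions of any sign. *)
Lemma cov_integral phi w (f : T -> \bar R) : cov phi w ->
  measurable_fun setT f ->
  (\int[mu]_x f x = \int[nu]_u (f (phi u) * (w u)%:E))%E.
Proof.
move=> [mphi mw w0 H] mf; rewrite integralE [RHS]integralE.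
rewrite H//; last exact: measurable_funepos.
rewrite H//; last exact: measurable_funeneg.
congr (_ - _)%E; apply: eq_integral => u _.
- by rewrite !funeposE muleC maxe_pMr ?lee_fin// mule0 muleC.
- by rewrite !funenegE muleC maxe_pMr ?lee_fin// mule0 muleN muleC.
Qed.

End def.


Section basic.
Context d1 d2 d3 (T : measurableType d1) (U : measurableType d2)
  (V : measurableType d3).
Variables (mu : {measure set T -> \bar R}) (nu : {measure set U -> \bar R})
  (rho : {measure set V -> \bar R}).

Lemma cov_comp phi w psi v : cov mu nu phi w -> cov nu rho psi v ->
  cov mu rho (phi \o psi) (fun z => w (psi z) * v z).
Proof.
move=> [mphi mw w0 H] [mpsi mv v0 K]; split.
- exact: measurableT_comp.
- by apply: measurable_funM => //; exact: measurableT_comp.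
- by move=> u; rewrite mulr_ge0.
- move=> f mf f0; rewrite H// K.
  + by apply: eq_integral => z _ /=; rewrite EFinM muleA.
  + apply: emeasurable_funM; first exact: measurableT_comp.
    exact/measurable_EFinP.
  + by move=> u; rewrite mule_ge0// lee_fin.
Qed.

(** [mu] is the image of [nu] under [phi]; pushing it on by [psi] gives back [nu], since
    [psi \o phi] is the identity. *)
Lemma cov_inv phi psi : cov mu nu phi (cst 1) -> measurable_fun setT psi ->
  cancel phi psi -> cov nu mu psi (cst 1).
Proof.
move=> [mphi _ _ H] mpsi phiK; split=> //.
move=> f mf f0; rewrite H.
- by apply: eq_integral => u _; rewrite phiK !mule1.
- by apply: emeasurable_funM => //; exact: measurableT_comp.
- by move=> x; rewrite mule1.
Qed.

End basic.

Lemma cov_id d (T : measurableType d) (mu : {measure set T -> \bar R}) :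
  cov mu mu id (cst 1).
Proof.
split=> //.
by move=> f _ _; apply: eq_integral => x _; rewrite mule1.
Qed.

Section product.
Context d1 d2 d3 (T : measurableType d1) (U : measurableType d2)
  (V : measurableType d3).
Variables (mu : {sigma_finite_measure set T -> \bar R})
  (nu : {sigma_finite_measure set U -> \bar R})
  (rho : {sigma_finite_measure set V -> \bar R}).

Lemma cov_swap : cov (sprod mu nu) (sprod nu mu) (fun z => (z.2, z.1)) (cst 1).
Proof.
have ms : measurable_fun setT (fun z : U * T => (z.2, z.1)) by exact: measurable_swap.
split=> //.
move=> f mf f0; rewrite sprod_integral2// sprod_integral1; last 2 first.
- by apply: emeasurable_funM => //; exact: measurableT_comp.
- by move=> x; rewrite mule1.
by apply: eq_integral => y _; apply: eq_integral => x _; rewrite mule1.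
Qed.

Lemma cov_assoc : cov (sprod (sprod mu nu) rho) (sprod mu (sprod nu rho))
  (fun z => ((z.1, z.2.1), z.2.2)) (cst 1).
Proof.
have mphi : measurable_fun setT (fun z : T * (U * V) => ((z.1, z.2.1), z.2.2)).
  apply/measurable_fun_pair => /=; last first.
    exact: (measurableT_comp measurable_snd).
  apply/measurable_fun_pair => //=.
  exact: (measurableT_comp measurable_fst).
split=> //.
move=> f mf f0.
rewrite sprod_integral1// sprod_integral1; last 2 first.
- exact: measurable_fun_fubini_tonelli_F.
- by move=> x; exact: integral_ge0.
have mf' : measurable_fun setT
  (fun z : T * (U * V) => f ((z.1, z.2.1), z.2.2) * (cst 1%R z)%:E)%E.
  by apply: emeasurable_funM => //; exact: measurableT_comp.
rewrite sprod_integral1//; last by move=> z; rewrite mule1.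
apply: eq_integral => x _; 
rewrite sprod_integral1; last 2 first.
- exact: measurableT_comp mf' (pair1_measurable _).
- by move=> z; rewrite mule1.
by apply: eq_integral => y _; apply: eq_integral => z _; rewrite mule1.
Qed.

End product.

Section fiber.
Context d1 d2 d3 (T : measurableType d1) (U : measurableType d2)
  (V : measurableType d3).
Variables (mu : {sigma_finite_measure set T -> \bar R})
  (nu : {sigma_finite_measure set U -> \bar R})
  (rho : {sigma_finite_measure set V -> \bar R}).

(** By Tonelli, a change of the second coordinate may depend on the first one as a parameter. The
    triangular substitutions below are built this way, their weights being multiplied by
    [cov_comp]. *)
Lemma cov_fiber (phi : V * U -> T) (w : V * U -> R) :
  measurable_fun setT phi -> measurable_fun setT w ->
  (forall x, cov mu nu (fun u => phi (x, u)) (fun u => w (x, u))) ->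
  cov (sprod rho mu) (sprod rho nu) (fun z => (z.1, phi z)) w.
Proof.
move=> mphi mw H.
have mPhi : measurable_fun setT (fun z : V * U => (z.1, phi z)).
  by apply/measurable_fun_pair.
have w0 u : 0 <= w u by case: u => x u; have [_ _ + _] := H x; exact.
split=> // f mf f0; rewrite sprod_integral1// sprod_integral1; last 2 first.
- apply: emeasurable_funM; first exact: measurableT_comp.
  exact/measurable_EFinP.
- by move=> u; rewrite mule_ge0// lee_fin.
apply: eq_integral => x _; have [_ _ _ ->//] := H x.
exact: measurableT_comp mf (pair1_measurable _).
Qed.

End fiber.

Section prod.
Context d1 d2 d3 d4 (T : measurableType d1) (U : measurableType d2)
  (T' : measurableType d3) (U' : measurableType d4).
Variables (mu : {sigma_finite_measure set T -> \bar R})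
  (nu : {sigma_finite_measure set U -> \bar R})
  (mu' : {sigma_finite_measure set T' -> \bar R})
  (nu' : {sigma_finite_measure set U' -> \bar R}).

(** [cov_fiber] acts on the second coordinate; the first one is reached by conjugating with
    swaps. *)
Lemma cov_prod phi w phi' w' : cov mu nu phi w -> cov mu' nu' phi' w' ->
  cov (sprod mu mu') (sprod nu nu') (fun z => (phi z.1, phi' z.2))
    (fun z => w z.1 * w' z.2).
Proof.
move=> H H'; have [mphi mw _ _] := H; have [mphi' mw' _ _] := H'.
have F : cov (sprod mu mu') (sprod mu nu') (fun z => (z.1, phi' z.2))
    (fun z => w' z.2).
  apply: (@cov_fiber _ _ _ _ _ _ mu' nu' mu (fun z => phi' z.2)
    (fun z => w' z.2)) => //; exact: measurableT_comp.
have G : cov (sprod nu' mu) (sprod nu' nu) (fun z => (z.1, phi z.2))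
    (fun z => w z.2).
  apply: (@cov_fiber _ _ _ _ _ _ mu nu nu' (fun z => phi z.2)
    (fun z => w z.2)) => //; exact: measurableT_comp.
apply: cov_ext (cov_comp F (cov_comp (cov_swap mu nu') (cov_comp G
  (cov_swap nu' nu)))) => -[x y] //=.
by rewrite mul1r mulr1 mulrC.
Qed.

End prod.

Section interchange.
Context d1 d2 d3 d4 (T : measurableType d1) (U : measurableType d2)
  (T' : measurableType d3) (U' : measurableType d4).
Variables (a : {sigma_finite_measure set T -> \bar R})
  (b : {sigma_finite_measure set U -> \bar R})
  (c : {sigma_finite_measure set T' -> \bar R})
  (e : {sigma_finite_measure set U' -> \bar R}).

Lemma cov_assocV d1' d2' d3' (X : measurableType d1') (Y : measurableType d2')
  (Z : measurableType d3') (mu : {sigma_finite_measure set X -> \bar R})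
  (nu : {sigma_finite_measure set Y -> \bar R})
  (rho : {sigma_finite_measure set Z -> \bar R}) :
  cov (sprod mu (sprod nu rho)) (sprod (sprod mu nu) rho)
  (fun z => (z.1.1, (z.1.2, z.2))) (cst 1).
Proof.
apply: cov_inv (cov_assoc mu nu rho) _ _; last by case=> x [].
apply/measurable_fun_pair => /=.
  exact: (measurableT_comp measurable_fst).
apply/measurable_fun_pair => //=.
exact: (measurableT_comp measurable_snd).
Qed.

Lemma cov_interchange :
  cov (sprod (sprod a b) (sprod c e)) (sprod (sprod a c) (sprod b e))
  (fun z => ((z.1.1, z.2.1), (z.1.2, z.2.2))) (cst 1).
Proof.
have M := cov_comp (cov_assocV b c e) (cov_comp
  (cov_prod (cov_swap b c) (cov_id e)) (cov_assoc c b e)).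
have := cov_comp (cov_assoc a b (sprod c e)) (cov_comp
  (cov_prod (cov_id a) M) (cov_assocV a c (sprod b e))).
by apply: cov_ext => -[[x y] [z t]] //=; rewrite !mulr1.
Qed.

End interchange.

(** * Product measures on tuples *)

Section tuple.
Context d (T : measurableType d) (m : {sigma_finite_measure set T -> \bar R}).

Lemma cov_cons n :
  cov (tuple_measure m n.+1) (sprod m (tuple_measure m n)) (@cons_pair _ T n)
    (cst 1).
Proof.
have mc := @measurable_cons_pair _ T n.
split=> //.
move=> f mf f0; under [RHS]eq_integral do rewrite mule1.
rewrite -(@ge0_integral_pushforward _ _ _ _ _ _ mc _ setT f)//.
Qed.

Lemma cov_uncons n :
  cov (sprod m (tuple_measure m n)) (tuple_measure m n.+1) (@uncons_tuple _ T n)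
    (cst 1).
Proof.
exact: cov_inv (cov_cons n) (@measurable_uncons_tuple _ T n) (@cons_pairK _ T n).
Qed.

Lemma tuple_measure0_integral (f : 0.-tuple T -> \bar R) :
  measurable_fun setT f ->
  (\int[tuple_measure m 0]_x f x = f [tuple])%E.
Proof. by move=> mf; rewrite /= integral_dirac// diracT mul1e. Qed.

End tuple.

Section tuple_map.
Context d d' (T : measurableType d) (T' : measurableType d').
Variables (m : {sigma_finite_measure set T -> \bar R})
  (m' : {sigma_finite_measure set T' -> \bar R}).

Lemma cov_tuple n (phi : 'I_n -> T' -> T) (w : 'I_n -> T' -> R) :
  (forall i, cov m m' (phi i) (w i)) ->
  cov (tuple_measure m n) (tuple_measure m' n)
    (fun t => [tuple phi i (tnth t i) | i < n])
    (fun t => \prod_i w i (tnth t i)).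
Proof.
elim: n phi w => [|n ih] phi w H.
  split.
  - by apply/measurable_fun_tnthP => i; have := ltn_ord i; rewrite ltn0.
  - rewrite (_ : (fun _ => _) = cst 1)//.
    by apply/funext => t; rewrite big_ord0.
  - by move=> t; rewrite big_ord0.
  - move=> f mf f0; rewrite !tuple_measure0_integral//.
      by rewrite big_ord0 mule1 [in RHS]tuple0.
    apply: emeasurable_funM; first apply: measurableT_comp => //.
      by apply/measurable_fun_tnthP => i; have := ltn_ord i; rewrite ltn0.
    apply/measurable_EFinP; rewrite (_ : (fun _ => _) = cst 1)//.
    by apply/funext => t; rewrite big_ord0.
have K := ih (fun i => phi (lift ord0 i)) (fun i => w (lift ord0 i))
  (fun i => H (lift ord0 i)).
have := cov_comp (cov_cons m n) (cov_comp (cov_prod (H ord0) K)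
  (cov_uncons m' n)).
apply: cov_ext => t /=.
  apply: eq_from_tnth => i; rewrite tnth_mktuple.
  have [j ->|->] := unliftP ord0 i; last by rewrite tnth0.
  by rewrite tnthS tnth_mktuple [in RHS](tuple_eta t) tnthS.
rewrite mul1r mulr1 big_ord_recl; congr (_ * _).
by apply: eq_bigr => i _; rewrite [in RHS](tuple_eta t) tnthS.
Qed.

End tuple_map.

Section zip.
Context d (T : measurableType d) (m : {sigma_finite_measure set T -> \bar R}).

(** Puts the column [z.1] in front of the array [z.2], row by row. Below the first row of a (p+1) x
    (p+1) array, this separates the first column from the p x p block. *)
Definition zipcons n q (z : n.-tuple T * n.-tuple (q.-tuple T)) :
    n.-tuple (q.+1.-tuple T) :=
  [tuple cons_pair (tnth z.1 i, tnth z.2 i) | i < n].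

Lemma measurable_zipcons n q : measurable_fun setT (@zipcons n q).
Proof.
apply/measurable_fun_tnthP => i.
rewrite (_ : _ \o _ = fun z => cons_pair (tnth z.1 i, tnth z.2 i)); last first.
  by apply/funext => z /=; rewrite tnth_mktuple.
apply: measurableT_comp; first exact: measurable_cons_pair.
apply/measurable_fun_pair.
  apply: (measurableT_comp (@measurable_tnth _ _ _ i)); exact: measurable_fst.
apply: (measurableT_comp (@measurable_tnth _ _ _ i)); exact: measurable_snd.
Qed.

Lemma cov_zipcons n q :
  cov (tuple_measure (tuple_measure m q.+1) n)
    (sprod (tuple_measure m n) (tuple_measure (tuple_measure m q) n))
    (@zipcons n q) (cst 1).
Proof.
elim: n => [|n ih].
  split; first exact: measurable_zipcons.
  - exact: measurable_cst.
  - by [].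
  move=> f mf f0; set g := fun z => (f (zipcons z) * (cst 1%R z)%:E)%E.
  have mg : measurable_fun setT g.
    apply: emeasurable_funM => //; apply: measurableT_comp => //.
    exact: measurable_zipcons.
  have g0 z : (0 <= g z)%E by rewrite /g mule1.
  rewrite tuple_measure0_integral// sprod_integral1// tuple_measure0_integral.
    rewrite tuple_measure0_integral; first by rewrite /g mule1 [in RHS]tuple0.
    exact: measurableT_comp mg (pair1_measurable _).
  exact: (measurable_fun_fubini_tonelli_F g).
have := cov_comp (cov_cons (tuple_measure m q.+1) n)
  (cov_comp (cov_prod (cov_cons m q) ih)
  (cov_comp (cov_interchange m (tuple_measure m q) (tuple_measure m n)
     (tuple_measure (tuple_measure m q) n))
  (cov_prod (cov_uncons m n) (cov_uncons (tuple_measure m q) n)))).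
apply: cov_ext => -[b Y] /=; last by rewrite !mulr1.
apply: eq_from_tnth => i; rewrite tnth_mktuple.
have [j ->|->] := unliftP ord0 i; last by rewrite /= !tnth0.
rewrite tnthS tnth_mktuple /=; congr (cons_pair (_, _)).
  by rewrite [in RHS](tuple_eta b) tnthS.
by rewrite [in RHS](tuple_eta Y) tnthS.
Qed.

End zip.

End change_of_variables.

(** * Affine maps and block coordinates on Hermitian matrices *)

Section lebesgue_coordinates.
Context {R : realType}.
Local Notation leb := (@lebesgue_measure R).
Local Notation RR := (measurableTypeR R).

Lemma cov_affine (a b : R) : 0 < a ->
  cov leb leb (fun x : RR => (a * x + b : RR)) (cst a).
Proof.
move=> a0; pose phi (x : RR) : RR := a * x + b.
have mphi : measurable_fun setT phi.
  by apply: measurable_funD => //; exact: measurable_funM.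
split => // [u|f mf f0]; first exact: ltW.
pose m := measure_function_pushforward__canonical__measure_function_Measure
    leb mphi.
pose k : {nonneg R} := NngNum (ltW a0).
(* Lebesgue measure is determined by its values on half-open intervals, whose preimages under [phi]
   are again such intervals since [a] is positive. *)
have E : forall A, measurable A -> leb A = mscale k m A.
  apply: lebesgue_measure_unique => _ [[c d] _ <-].
  change (leb `]c, d]%classic = a%:E * leb (phi @^-1` `]c, d]%classic))%E.
  have -> : phi @^-1` `]c, d]%classic = `](c - b) / a, (d - b) / a]%classic.
    apply/seteqP; split => x /=; rewrite !in_itv/= /phi.
      by rewrite ltr_pdivrMr// ler_pdivlMr// ltrBlDr lerBrDr (mulrC x).
    by rewrite ltr_pdivrMr// ler_pdivlMr// ltrBlDr lerBrDr (mulrC x).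
  rewrite !lebesgue_measure_itv/= !lte_fin ltr_pM2r ?invr_gt0// ltrD2r.
  case: ifPn => _; last by rewrite mule0.
  rewrite -!EFinD -EFinM; congr EFin.
  by rewrite -mulrBl opprD opprK addrACA addNr addr0 mulrCA mulfV ?mulr1// gt_eqF.
rewrite (eq_measure_integral (mscale k m)); last by move=> A mA _; exact: E.
rewrite ge0_integral_mscale//= ge0_integral_pushforward//=.
under [RHS]eq_integral do rewrite muleC.
by rewrite ge0_integralZl//= ?lee_fin ?ltW//; exact: measurableT_comp.
Qed.

Definition taff n (a : R) (b t : n.-tuple RR) : n.-tuple RR :=
  [tuple (a * tnth t i + tnth b i : RR) | i < n].

Lemma cov_taff n (a : R) (b : n.-tuple RR) : 0 < a ->
  cov (tuple_measure leb n) (tuple_measure leb n) (taff a b) (cst (a ^+ n)).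
Proof.
move=> a0.
have := cov_tuple (fun i : 'I_n => cov_affine (tnth b i) a0).
by apply: cov_ext => // t /=; rewrite prodr_const card_ord.
Qed.

Definition cleb p : {sigma_finite_measure set (p.-tuple RR * p.-tuple RR)%type -> \bar R} :=
  sprod (tuple_measure leb p) (tuple_measure leb p).
Definition hleb p : {sigma_finite_measure set (hermcoord R p) -> \bar R} :=
  tuple_measure (tuple_measure leb p) p.

(** In the array of a Hermitian matrix, [z.1] is the corner, [z.2.1.1] the rest of the first row
    (real parts of the border), [z.2.1.2] the rest of the first column (its imaginary parts) and
    [z.2.2] the lower right block. *)
Definition hglue p
    (z : RR * ((p.-tuple RR * p.-tuple RR) * p.-tuple (p.-tuple RR))) :
    hermcoord R p.+1 :=
  cons_pair (cons_pair (z.1, z.2.1.1), zipcons (z.2.1.2, z.2.2)).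

Lemma cov_hglue p :
  cov (hleb p.+1) (sprod leb (sprod (cleb p) (hleb p))) (@hglue p) (cst 1).
Proof.
have := cov_comp (cov_cons (tuple_measure leb p.+1) p)
  (cov_comp (cov_prod (cov_cons leb p) (cov_zipcons leb p p))
  (cov_comp (cov_assoc leb (tuple_measure leb p)
     (sprod (tuple_measure leb p) (hleb p)))
    (cov_prod (cov_id leb) (cov_assocV (tuple_measure leb p)
      (tuple_measure leb p) (hleb p))))).
by apply: cov_ext => // z; rewrite /= !mulr1.
Qed.

Definition haff p (b t : hermcoord R p) : hermcoord R p :=
  [tuple taff 1 (tnth b i) (tnth t i) | i < p].

Lemma cov_haff p (b : hermcoord R p) :
  cov (hleb p) (hleb p) (haff b) (cst 1).
Proof.
have := cov_tuple (fun i : 'I_p => cov_taff (tnth b i) (@ltr01 R)).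
by apply: cov_ext => // t /=; rewrite prodr_const expr1n expr1n.
Qed.

End lebesgue_coordinates.

(** * Integrals of complex functions *)

Section complex_measurable.
Context {R : realType}.
Local Notation C := R[i].
Local Open Scope complex_scope.
Local Notation Re := complex.Re.
Local Notation Im := complex.Im.
Local Notation normc := Normc.normc.

Lemma cReM (x y : C) : Re (x * y) = Re x * Re y - Im x * Im y.
Proof. by case: x => a b; case: y. Qed.

Lemma cImM (x y : C) : Im (x * y) = Re x * Im y + Im x * Re y.
Proof. by case: x => a b; case: y => c e /=; rewrite [b * c]mulrC. Qed.

Lemma normc_ge0 (z : C) : 0 <= normc z.
Proof. by case: z => a b; exact: sqrtr_ge0. Qed.

Lemma normc_real (r : R) : normc r%:C = `|r|.
Proof.
by rewrite -[r%:C]/(r +i* 0) /Normc.normc [0 ^+ 2]expr0n addr0 sqrtr_sqr.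
Qed.

Lemma ler_normRe (z : C) : `|Re z| <= normc z.
Proof.
case: z => a b /=; rewrite -sqrtr_sqr ler_wsqrtr// lerDl; exact: sqr_ge0.
Qed.

Lemma ler_normIm (z : C) : `|Im z| <= normc z.
Proof.
case: z => a b /=; rewrite -sqrtr_sqr ler_wsqrtr// lerDr; exact: sqr_ge0.
Qed.

Lemma normc_le_ReIm (z : C) : normc z <= `|Re z| + `|Im z|.
Proof.
case: z => a b /=; rewrite -[leRHS]ger0_norm ?addr_ge0//.
rewrite -sqrtr_sqr ler_wsqrtr// sqrrD !real_normK ?num_real//.
by rewrite lerD2r lerDl mulrn_wge0// mulr_ge0.
Qed.

Section cmeas.
Context d (T : measurableType d).
Implicit Types f g : T -> C.

Definition cmeas f := measurable_fun setT (fun x => Re (f x)) /\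
  measurable_fun setT (fun x => Im (f x)).

Lemma cmeas_cst c : cmeas (cst c).
Proof. by split; exact: measurable_cst. Qed.

Lemma cmeas_real (f : T -> R) : measurable_fun setT f -> cmeas (fun x => (f x)%:C).
Proof. by move=> mf; split=> //=; exact: measurable_cst. Qed.

Lemma cmeasD f g : cmeas f -> cmeas g -> cmeas (fun x => f x + g x).
Proof.
move=> [mf1 mf2] [mg1 mg2]; split.
  rewrite (_ : (fun _ => _) = fun x => Re (f x) + Re (g x)).
    exact: measurable_funD.
  by apply/funext => x; rewrite raddfD.
rewrite (_ : (fun _ => _) = fun x => Im (f x) + Im (g x)).
  exact: measurable_funD.
by apply/funext => x; rewrite raddfD.
Qed.

Lemma cmeasN f : cmeas f -> cmeas (fun x => - f x).
Proof.
move=> [mf1 mf2]; split.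
  rewrite (_ : (fun _ => _) = fun x => - Re (f x)); first exact: measurableT_comp.
  by apply/funext => x; rewrite raddfN.
rewrite (_ : (fun _ => _) = fun x => - Im (f x)); first exact: measurableT_comp.
by apply/funext => x; rewrite raddfN.
Qed.

Lemma cmeas_conj f : cmeas f -> cmeas (fun x => Num.conj (f x)).
Proof.
move=> [mf1 mf2]; split.
  rewrite (_ : (fun _ => _) = fun x => Re (f x))//.
  by apply/funext => x; case: (f x).
rewrite (_ : (fun _ => _) = fun x => - Im (f x)); first exact: measurableT_comp.
by apply/funext => x; case: (f x).
Qed.

Lemma cmeasM f g : cmeas f -> cmeas g -> cmeas (fun x => f x * g x).
Proof.
move=> [mf1 mf2] [mg1 mg2]; split.
  under eq_fun do rewrite cReM.
  by apply: measurable_funB; exact: measurable_funM.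
under eq_fun do rewrite cImM.
by apply: measurable_funD; exact: measurable_funM.
Qed.

Lemma cmeas_sum (I : Type) (s : seq I) (F : I -> T -> C) :
  (forall i, cmeas (F i)) -> cmeas (fun x => \sum_(i <- s) F i x).
Proof.
move=> H; elim: s => [|i s ih].
  by under eq_fun do rewrite big_nil; exact: cmeas_cst.
by under eq_fun do rewrite big_cons; exact: cmeasD.
Qed.

Lemma cmeas_prod (I : Type) (s : seq I) (F : I -> T -> C) :
  (forall i, cmeas (F i)) -> cmeas (fun x => \prod_(i <- s) F i x).
Proof.
move=> H; elim: s => [|i s ih].
  by under eq_fun do rewrite big_nil; exact: cmeas_cst.
by under eq_fun do rewrite big_cons; exact: cmeasM.
Qed.

Lemma cmeas_if (A : set T) f : measurable A -> cmeas f ->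
  cmeas (fun x => if `[< A x >] then f x else 0).
Proof.
move=> mA [mf1 mf2].
have mb : measurable_fun setT (fun x => `[< A x >]).
  apply: (measurable_fun_bool true); rewrite setTI.
  by rewrite (_ : _ @^-1` _ = A)//; apply/seteqP; split => x /= /asboolP.
split.
  rewrite (_ : (fun _ => _) = fun x => if `[< A x >] then Re (f x) else 0).
    exact: measurable_fun_ifT.
  by apply/funext => x; case: ifP.
rewrite (_ : (fun _ => _) = fun x => if `[< A x >] then Im (f x) else 0).
  exact: measurable_fun_ifT.
by apply/funext => x; case: ifP.
Qed.

Lemma measurable_normc f : cmeas f -> measurable_fun setT (fun x => normc (f x)).
Proof.
move=> [mf1 mf2].
rewrite (_ : (fun _ => _) = fun x => Num.sqrt (Re (f x) ^+ 2 + Im (f x) ^+ 2)).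
  apply: measurableT_comp.
    by apply: continuous_measurable_fun; exact: sqrt_continuous.
  by apply: measurable_funD; exact: measurable_funX.
by apply/funext => x; case: (f x).
Qed.

End cmeas.

Lemma cmeas_comp d d' (T : measurableType d) (U : measurableType d')
    (f : T -> C) (phi : U -> T) :
  cmeas f -> measurable_fun setT phi -> cmeas (fun u => f (phi u)).
Proof. by move=> [mf1 mf2] mphi; 
  split; [exact: (measurableT_comp mf1 mphi)|exact: (measurableT_comp mf2 mphi)].
Qed.

Section cintegral_theory.
Context d (T : measurableType d) (mu : {measure set T -> \bar R}).
Implicit Types f g : T -> C.

(** Follows from max(|Re z|, |Im z|) <= |z| <= |Re z| + |Im z|. The modulus is what Tonelli and
    domination arguments work with. *)
Lemma cintegrableP f : cintegrable mu setT f <->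
  cmeas f /\ (\int[mu]_x (normc (f x))%:E < +oo)%E.
Proof.
split=> [[/integrableP[m1 i1] /integrableP[m2 i2]]|[[m1 m2] i]].
  have mf : cmeas f by split; exact/measurable_EFinP.
  split => //; apply: (@le_lt_trans _ _
      (\int[mu]_x (`|(Re (f x))%:E| + `|(Im (f x))%:E|))%E); last first.
    rewrite ge0_integralD//; first exact: lte_add_pinfty.
    - exact: measurableT_comp.
    - exact: measurableT_comp.
  apply: ge0_le_integral => //.
  - by move=> x _; rewrite lee_fin normc_ge0.
  - by apply/measurable_EFinP; exact: measurable_normc.
  - by apply: emeasurable_funD; exact: measurableT_comp.
  - by move=> x _; rewrite lee_fin normc_le_ReIm.
have mn : measurable_fun setT (fun x => (normc (f x))%:E).
  by apply/measurable_EFinP; exact: measurable_normc.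
split; apply/integrableP; split => //; try exact/measurable_EFinP.
  apply: le_lt_trans i; apply: ge0_le_integral => //.
  - by apply: measurableT_comp => //; exact/measurable_EFinP.
  - by move=> x _; rewrite lee_fin ler_normRe.
apply: le_lt_trans i; apply: ge0_le_integral => //.
- by apply: measurableT_comp => //; exact/measurable_EFinP.
- by move=> x _; rewrite lee_fin ler_normIm.
Qed.

Lemma cintegrable_cmeas f : cintegrable mu setT f -> cmeas f.
Proof. by move/cintegrableP => []. Qed.

Lemma eq_cintegral f g : f =1 g -> cintegral mu setT f = cintegral mu setT g.
Proof. by move=> /funext->. Qed.

Lemma cintegrableZ c f : cintegrable mu setT f ->
  cintegrable mu setT (fun x => c * f x).
Proof.
move=> [i1 i2]; split.
  under eq_fun do rewrite cReM EFinB !EFinM.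
  by apply: integrableB => //; exact: integrableZl.
under eq_fun do rewrite cImM EFinD !EFinM.
by apply: integrableD => //; exact: integrableZl.
Qed.

Lemma cintegralZ c f : cintegrable mu setT f ->
  cintegral mu setT (fun x => c * f x) = c * cintegral mu setT f.
Proof.
move=> [i1 i2]; rewrite /cintegral.
have iZ (a : R) (h : T -> R) : mu.-integrable setT (EFin \o h) ->
    mu.-integrable setT (EFin \o (fun x => a * h x)).
  move=> ih; rewrite (_ : _ \o _ = fun x => (a%:E * (h x)%:E)%E)//.
  exact: integrableZl.
under [X in X +i* _]eq_Rintegral do rewrite cReM.
under [X in _ +i* X]eq_Rintegral do rewrite cImM.
rewrite RintegralB//=; try exact: iZ.
rewrite RintegralD//=; try exact: iZ.
by rewrite !RintegralZl//; apply/eqP; rewrite eq_complex cReM cImM !eqxx.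
Qed.

Lemma cintegralD f g : cintegrable mu setT f -> cintegrable mu setT g ->
  cintegral mu setT (fun x => f x + g x) =
  cintegral mu setT f + cintegral mu setT g.
Proof.
move=> [i1 i2] [j1 j2]; rewrite /cintegral.
under [X in X +i* _]eq_Rintegral do rewrite raddfD.
under [X in _ +i* X]eq_Rintegral do rewrite raddfD.
by rewrite RintegralD// RintegralD.
Qed.

End cintegral_theory.

Section cov_complex.
Context d1 d2 (T : measurableType d1) (U : measurableType d2).
Variables (mu : {measure set T -> \bar R}) (nu : {measure set U -> \bar R}).
Variables (phi : U -> T) (w : U -> R).
Hypothesis H : cov mu nu phi w.

Lemma cov_cmeas (f : T -> C) : cmeas f -> cmeas (fun u => f (phi u) * (w u)%:C).
Proof.
have [mphi mw _ _] := H.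
by move=> mf; apply: cmeasM; [exact: cmeas_comp|exact: cmeas_real].
Qed.

Lemma cov_cintegrable (f : T -> C) : cmeas f ->
  cintegrable mu setT f <->
  cintegrable nu setT (fun u => f (phi u) * (w u)%:C).
Proof.
have [mphi mw w0 K] := H.
move=> mf; have E : (\int[mu]_x (normc (f x))%:E)%E =
    (\int[nu]_u (normc (f (phi u) * (w u)%:C))%:E)%E.
  rewrite K.
  - apply: eq_integral => u _; rewrite -EFinM Normc.normcM.
    by rewrite normc_real ger0_norm.
  - by apply/measurable_EFinP; exact: measurable_normc.
  - by move=> x; rewrite lee_fin normc_ge0.
split=> /cintegrableP[_ i]; apply/cintegrableP; split => //.
- exact: cov_cmeas.
- by rewrite -E.
- by rewrite E.
Qed.

Lemma cov_cintegral (f : T -> C) : cmeas f ->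
  cintegral mu setT f = cintegral nu setT (fun u => f (phi u) * (w u)%:C).
Proof.
move=> [m1 m2]; rewrite /cintegral /Rintegral.
rewrite (cov_integral H); last exact/measurable_EFinP.
rewrite (cov_integral H); last exact/measurable_EFinP.
congr (fine _ +i* fine _); apply: eq_integral => u _; rewrite -EFinM.
  by rewrite cReM/= mulr0 subr0.
by rewrite cImM/= mulr0 add0r.
Qed.

End cov_complex.

(** * Fubini's theorem for complex integrands *)

Section cfubini.
Context d1 d2 (T : measurableType d1) (U : measurableType d2).
Variables (mu : {sigma_finite_measure set T -> \bar R})
  (nu : {sigma_finite_measure set U -> \bar R}).

Lemma cintegrable_sprod (f : T * U -> C) : cmeas f ->
  (\int[mu]_x \int[nu]_y (normc (f (x, y)))%:E < +oo)%E ->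
  cintegrable (sprod mu nu) setT f.
Proof.
move=> mf i; apply/cintegrableP; split => //.
rewrite sprod_integral1//.
- by apply/measurable_EFinP; exact: measurable_normc.
- by move=> z; rewrite lee_fin normc_ge0.
Qed.

Let rfubini (g : T * U -> R) : (sprod mu nu).-integrable setT (EFin \o g) ->
  (forall x, nu.-integrable setT (fun y => (g (x, y))%:E)) ->
  mu.-integrable setT (fun x => (\int[nu]_y g (x, y))%:E) /\
  \int[sprod mu nu]_z g z = \int[mu]_x \int[nu]_y g (x, y).
Proof.
move=> ig ig1.
(* Integrability of every section makes all inner integrals finite, so [fine] loses nothing at any x
   and the real-valued inner integral equals the extended one everywhere. *)
have E : (fun x => (\int[nu]_y g (x, y))%:E) =
    (fun x => \int[nu]_y (EFin \o g) (x, y))%E.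
  apply/funext => x; rewrite /Rintegral fineK//.
  exact: integrable_fin_num (ig1 x).
split; first by rewrite E; exact: (@integrable_fubini_F _ _ _ _ _ mu nu _ ig).
rewrite /Rintegral; congr fine.
rewrite -(@integral12_prod_meas1 _ _ _ _ _ mu nu (EFin \o g) ig).
by apply: eq_integral => x _; rewrite -[RHS]/((fun x => (\int[nu]_y g (x, y))%:E) x) E.
Qed.

Lemma cfubini (f : T * U -> C) : cintegrable (sprod mu nu) setT f ->
  (forall x, cintegrable nu setT (fun y => f (x, y))) ->
  cintegrable mu setT (fun x => cintegral nu setT (fun y => f (x, y))) /\
  cintegral (sprod mu nu) setT f =
  cintegral mu setT (fun x => cintegral nu setT (fun y => f (x, y))).
Proof.
move=> [i1 i2] H.
have [r1 e1] := rfubini i1 (fun x => (H x).1).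
have [r2 e2] := rfubini i2 (fun x => (H x).2).
by split => //; rewrite /cintegral e1 e2.
Qed.

Lemma cintegral_sprodM (f : T -> C) (g : U -> C) :
  cintegrable mu setT f -> cintegrable nu setT g ->
  cintegrable (sprod mu nu) setT (fun z => f z.1 * g z.2) /\
  cintegral (sprod mu nu) setT (fun z => f z.1 * g z.2) =
  cintegral mu setT f * cintegral nu setT g.
Proof.
move=> If Ig; have /cintegrableP[mf fi] := If; have /cintegrableP[mg gi] := Ig.
have mfg : cmeas (fun z : T * U => f z.1 * g z.2).
  by apply: cmeasM; apply: cmeas_comp.
have I : cintegrable (sprod mu nu) setT (fun z => f z.1 * g z.2).
  apply: cintegrable_sprod => //=.
  under eq_integral => x _.
    under eq_integral do rewrite Normc.normcM EFinM.
    rewrite ge0_integralZl//; last 3 first.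
    - by apply/measurable_EFinP; exact: measurable_normc.
    - by move=> y _; rewrite lee_fin normc_ge0.
    - by rewrite lee_fin normc_ge0.
    over.
  rewrite ge0_integralZr//=.
  - apply: lte_mul_pinfty => //.
    + by apply: integral_ge0 => x _; rewrite lee_fin normc_ge0.
    + rewrite ge0_fin_numE//.
      by apply: integral_ge0 => x _; rewrite lee_fin normc_ge0.
  - by apply/measurable_EFinP; exact: measurable_normc.
  - by move=> x _; rewrite lee_fin normc_ge0.
  - by apply: integral_ge0 => y _; rewrite lee_fin normc_ge0.
split => //.
have [_ ->] := cfubini I (fun x => cintegrableZ (f x) Ig).
rewrite (@eq_cintegral _ _ _ _ (fun x => cintegral nu setT g * f x)).
  by rewrite cintegralZ// mulrC.
by move=> x; exact: etrans (cintegralZ (f x) Ig) (mulrC _ _).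
Qed.

End cfubini.

Lemma cintegral_tupleM d (T : measurableType d)
    (m : {sigma_finite_measure set T -> \bar R}) n (f : 'I_n -> T -> C) :
  (forall i, cintegrable m setT (f i)) ->
  cintegrable (tuple_measure m n) setT (fun t => \prod_i f i (tnth t i)) /\
  cintegral (tuple_measure m n) setT (fun t => \prod_i f i (tnth t i)) =
  \prod_i cintegral m setT (f i).
Proof.
elim: n f => [|n ih] f If.
  have -> : (fun t : 0.-tuple T => \prod_i f i (tnth t i)) = cst 1.
    by apply/funext => t; rewrite big_ord0.
  rewrite big_ord0; split.
    apply/cintegrableP; split; first exact: cmeas_cst.
    rewrite tuple_measure0_integral.
      by rewrite ltry.
    by apply/measurable_EFinP; apply: measurable_normc; exact: cmeas_cst.
  by rewrite /cintegral /Rintegral !tuple_measure0_integral//;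
    apply/measurable_EFinP; [exact: (cmeas_cst _ 1).2|exact: (cmeas_cst _ 1).1].
have mP k (g : 'I_k -> T -> C) : (forall i, cintegrable m setT (g i)) ->
    cmeas (fun t : k.-tuple T => \prod_i g i (tnth t i)).
  move=> Ig; apply: cmeas_prod => i; apply: (cmeas_comp (phi := (@tnth _ _)^~ i)).
    exact: cintegrable_cmeas (Ig i).
  exact: measurable_tnth.
have [I E] := ih (fun i => f (lift ord0 i)) (fun i => If (lift ord0 i)).
have [I' E'] := cintegral_sprodM (If ord0) I.
have K := cov_cons m n; have mPf := mP _ _ If.
have X : (fun z : T * n.-tuple T =>
    (\prod_i f i (tnth (cons_pair z) i)) * ((cst 1%R z)%:C)) =
    (fun z => f ord0 z.1 * \prod_i f (lift ord0 i) (tnth z.2 i)).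
  apply/funext => z; rewrite mulr1 big_ord_recl; congr (_ * _).
  by apply: eq_bigr => i _; rewrite tnthS.
split; first by apply/(cov_cintegrable K mPf); rewrite X.
by rewrite (cov_cintegral K mPf) X E' E big_ord_recl.
Qed.

End complex_measurable.

(** * Complex powers *)

Section complex_powers.
Context {R : realType}.
Local Notation C := R[i].
Local Open Scope complex_scope.
Local Notation Re := complex.Re.
Local Notation Im := complex.Im.
Local Notation normc := Normc.normc.
Implicit Types (z w : C) (s t : R).

Lemma expCD z w : expC (z + w) = expC z * expC w.
Proof.
case: z w => a b [c e]; rewrite /expC /= expRD cosD sinD.
by apply/eqP; rewrite eq_complex /=; apply/andP; split; apply/eqP; ring.
Qed.

Lemma expC0 : expC 0 = 1 :> C.
Proof. by rewrite /expC /= expR0 cos0 sin0 mulr0 mulr1. Qed.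

Lemma normc_expC z : normc (expC z) = expR (Re z).
Proof.
rewrite /expC /= !exprMn -mulrDr cos2Dsin2 mulr1 sqrtr_sqr ger0_norm//.
Qed.

Lemma expC_real (r : R) : expC r%:C = (expR r)%:C.
Proof. by rewrite /expC /= cos0 sin0 mulr1 mulr0. Qed.

Lemma rpowCD t z w : rpowC t (z + w) = rpowC t z * rpowC t w.
Proof. by rewrite /rpowC mulrDl expCD. Qed.

Lemma rpowC0 t : rpowC t 0 = 1.
Proof. by rewrite /rpowC mul0r expC0. Qed.

Lemma rpowCM s t z : 0 < s -> 0 < t -> rpowC (s * t) z = rpowC s z * rpowC t z.
Proof. by move=> s0 t0; rewrite /rpowC lnM ?posrE// rmorphD mulrDr expCD. Qed.

Lemma rpow1C z : rpowC 1 z = 1.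
Proof. by rewrite /rpowC ln1 mulr0 expC0. Qed.

Lemma normc_rpowC t z : normc (rpowC t z) = expR (Re z * ln t).
Proof. by rewrite /rpowC normc_expC cReM /= mulr0 subr0. Qed.

Lemma rpowC1 t : 0 < t -> rpowC t 1 = t%:C.
Proof. by move=> t0; rewrite /rpowC mul1r expC_real lnK. Qed.

Lemma rpowC_nat t n : 0 < t -> rpowC t n%:R = (t ^+ n)%:C.
Proof.
move=> t0; elim: n => [|n ih]; first by rewrite rpowC0.
by rewrite -natr1 rpowCD ih rpowC1// exprSr rmorphM.
Qed.

Lemma rpowC_real t (r : R) : rpowC t r%:C = (expR (r * ln t))%:C.
Proof. by rewrite /rpowC -rmorphM expC_real. Qed.

Lemma Re_rpowC t z : Re (rpowC t z) = expR (Re z * ln t) * cos (Im z * ln t).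
Proof. by rewrite /rpowC /= cReM cImM /= !mulr0 subr0 add0r. Qed.

Lemma Im_rpowC t z : Im (rpowC t z) = expR (Re z * ln t) * sin (Im z * ln t).
Proof. by rewrite /rpowC /= cReM cImM /= !mulr0 subr0 add0r. Qed.

Lemma cmeas_rpowC d (T : measurableType d) (f : T -> R) z :
  measurable_fun setT f -> cmeas (fun x => rpowC (f x) z).
Proof.
move=> mf.
have ml : measurable_fun setT (fun x => ln (f x)).
  exact: (measurableT_comp (@measurable_ln R)).
have mZ (a : R) : measurable_fun setT (fun x => a * ln (f x)).
  by apply: measurable_funM.
split.
  under eq_fun do rewrite Re_rpowC.
  apply: measurable_funM; first exact: measurableT_comp.
  apply: (measurableT_comp _ (mZ _)).
  by apply: continuous_measurable_fun; exact: continuous_cos.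
under eq_fun do rewrite Im_rpowC.
apply: measurable_funM; first exact: measurableT_comp.
apply: (measurableT_comp _ (mZ _)).
by apply: continuous_measurable_fun; exact: continuous_sin.
Qed.

Lemma FTC_pos (F f : R -> R) (a b : R) : 0 < a -> a < b ->
  (forall x : R, 0 < x -> is_derive x 1 F (f x)) ->
  (forall x : R, 0 < x -> derivable f x 1) ->
  (\int[@lebesgue_measure R]_(x in `[a, b]) (f x)%:E = (F b - F a)%:E)%E.
Proof.
move=> a0 ab dF df.
have cF x : 0 < x -> {for x, continuous F}.
  move=> x0; apply/differentiable_continuous/derivable1_diffP.
  by have [] := dF x x0.
rewrite (@continuous_FTC2 _ _ F)// ?EFinB//.
- apply: derivable_within_continuous => x; rewrite in_itv/= => /andP[ax _].
  by apply: df; exact: lt_le_trans ax.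
- split.
  + move=> x; rewrite in_itv/= => /andP[ax _].
    by have [] := dF x (lt_trans a0 ax).
  + exact/cvg_at_right_filter/cF.
  + by apply/cvg_at_left_filter/cF; exact: lt_trans ab.
- move=> x; rewrite in_itv/= => /andP[ax _].
  by have [_ <-] := dF x (lt_trans a0 ax); rewrite derive1E.
Qed.

End complex_powers.

(** * The complex gamma function *)

Section gamma_integrable.
Context {R : realType}.
Local Notation C := R[i].
Local Notation leb := (@lebesgue_measure R).
Local Open Scope complex_scope.
Local Notation Re := complex.Re.
Local Notation Im := complex.Im.
Local Notation normc := Normc.normc.
Implicit Types x y s t : R.

Lemma is_derive_expRln x t : 0 < t ->
  is_derive t 1 (fun s => expR (x * ln s)) (expR (x * ln t) * (x * t^-1)).
Proof.
move=> t0; have L := is_derive1_ln t0.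
by apply: is_derive_eq; rewrite /GRing.scale/=; ring.
Qed.

(* A bounded primitive of a function of the order of t^(x-1) at 0. *)
Lemma is_derive_inv1DexpRln x t : 0 < t ->
  is_derive t 1 (fun s => - (1 + expR (x * ln s))^-1)
   ((1 + expR (x * ln t)) ^- 2 * (expR (x * ln t) * (x * t^-1))).
Proof.
move=> t0; have L := is_derive_expRln x t0.
have P : 1 + expR (x * ln t) != 0 by rewrite gt_eqF// addr_gt0// expR_gt0.
apply: is_derive_eq.
by rewrite /GRing.scale/=; ring.
Qed.

Let derivable_mul (f g : R -> R) t : derivable f t 1 -> derivable g t 1 ->
  derivable (fun s => f s * g s) t 1.
Proof. exact: derivableM. Qed.

Let derivable_inv (f : R -> R) t : f t != 0 -> derivable f t 1 ->
  derivable (fun s => (f s)^-1) t 1.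
Proof. exact: derivableV. Qed.

Let derivable_continuous_at (f : R -> R) (t : R) : derivable f t 1 ->
  {for t, continuous f}.
Proof. by move=> df; apply/differentiable_continuous/derivable1_diffP. Qed.

Lemma derivable_inv1DexpRln' x t : 0 < t ->
  derivable (fun s => (1 + expR (x * ln s)) ^- 2 * (expR (x * ln s) * (x * s^-1))) t 1.
Proof.
move=> t0; have [D _] := is_derive_expRln x t0.
have D1 : derivable (fun s => 1 + expR (x * ln s)) t 1.
  exact: (derivableD (derivable_cst (1 : R) t 1) D).
have P : (1 + expR (x * ln t)) * (1 + expR (x * ln t)) != 0.
  by rewrite mulf_neq0// gt_eqF// addr_gt0// expR_gt0.
have D2 := @derivable_inv (fun s => (1 + expR (x * ln s)) * (1 + expR (x * ln s)))
  t P (derivable_mul D1 D1).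
have Q : t != 0 by rewrite gt_eqF.
have D3 := derivable_mul (derivable_cst x t 1)
  (@derivable_inv id t Q ltac:(exact: derivable_id)).
exact: (derivable_mul D2 (derivable_mul D D3)).
Qed.

(** Compact intervals away from 0, where [ln] is differentiable. The shift by 2 keeps the left
    endpoint strictly below the right one for n = 0 too. *)
Lemma itv0y_bigcup :
  `]0, +oo[%classic = \bigcup_n `[(n.+2%:R)^-1, n.+2%:R]%classic :> set R.
Proof.
apply/seteqP; split => [t /=|t [n _] /=]; rewrite !in_itv/= ?andbT.
  move=> t0; pose m := (Num.truncn t).+1; pose n := (Num.truncn t^-1).+1.
  exists (maxn n m) => //=; rewrite in_itv/=; apply/andP; split.
    rewrite -[t]invrK lef_pV2 ?posrE ?invr_gt0//.
    apply: le_trans (ltW (truncnS_gt _)) _; rewrite ler_nat.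
    by apply: leq_trans (leq_maxl n m) _; rewrite -addn2 leq_addr.
  apply: le_trans (ltW (truncnS_gt _)) _; rewrite ler_nat.
  by apply: leq_trans (leq_maxr n m) _; rewrite -addn2 leq_addr.
by move=> /andP[+ _]; apply: lt_le_trans; rewrite invr_gt0.
Qed.

(** The primitive -1/(1 + t^x) takes its values between -1 and 0, so each compact integral is at
    most 1; monotone convergence passes to ]0, +oo[. *)
Lemma integral_inv1DexpRln x : 0 < x ->
  (\int[leb]_(t in `]0%R, +oo[)
    ((1 + expR (x * ln t)) ^- 2 * (expR (x * ln t) * (x * t^-1)))%R%:E <= 1)%E.
Proof.
move=> x0; pose h (t : R) : R :=
  (1 + expR (x * ln t)) ^- 2 * (expR (x * ln t) * (x * t^-1)).
have h0 t : 0 < t -> 0 <= h t.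
  move=> t0; rewrite /h !mulr_ge0// ?expR_ge0// ?invr_ge0 ?sqr_ge0 ?ltW//.
have mh : measurable_fun (`]0, +oo[%classic : set R) (fun t => (h t)%:E).
  apply/measurable_EFinP; apply: open_continuous_measurable_fun => // t.
  rewrite inE/= in_itv/= andbT => t0.
  exact/derivable_continuous_at/derivable_inv1DexpRln'.
have F0 n t : t \in `[(n.+2%:R)^-1, n.+2%:R] -> 0 < t.
  by rewrite in_itv/= => /andP[+ _]; apply: lt_le_trans; rewrite invr_gt0.
rewrite itv0y_bigcup.
have cv := @ge0_nondecreasing_set_cvg_integral _ (measurableTypeR R) R
  (fun n => `[(n.+2%:R)^-1, n.+2%:R]%classic) (fun t => (h t)%:E) leb.
apply: cvge_le (cv _ _ _ _).
- apply: nearW => n; rewrite (FTC_pos _ _ (is_derive_inv1DexpRln x)).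
  + rewrite lee_fin opprK addrC lerBlDr.
    rewrite (@le_trans _ _ 1)//.
      by rewrite invf_le1 ?addr_gt0// ?expR_gt0// lerDl expR_ge0.
    by rewrite lerDl invr_ge0 addr_ge0// expR_ge0.
  + by rewrite invr_gt0.
  + by rewrite (@lt_trans _ _ 1)// ?invf_lt1// ltr1n.
  + by move=> t; exact: derivable_inv1DexpRln'.
- move=> m n mn; apply/subsetPset => t; rewrite /= !in_itv/= => /andP[a b].
  rewrite (le_trans _ a) ?(le_trans b)//.
    by rewrite ler_nat !ltnS.
  by rewrite lef_pV2 ?posrE// ler_nat !ltnS.
- by move=> n.
- move=> n; apply: measurable_funS mh => // t /= /F0 t0.
  by rewrite in_itv/= t0.
- by move=> n t /= /F0 t0; rewrite lee_fin h0.
Qed.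

Lemma cmeas_ifb d (T : measurableType d) (b : T -> bool) (f : T -> C) :
  measurable_fun setT b -> cmeas f -> cmeas (fun z => if b z then f z else 0).
Proof.
move=> mb mf.
rewrite (_ : (fun _ => _) = fun z => if `[< [set z | b z] z >] then f z else 0).
  apply: cmeas_if mf.
  by rewrite -[X in measurable X]setTI; exact: (mb measurableT [set true]).
by apply/funext => z; rewrite asboolb.
Qed.

Definition gammaf (a : C) (t : R) : C :=
  if 0 < t then rpowC t (a - 1) * (expR (- t))%:C else 0.

Lemma cmeas_gammaf a : cmeas (gammaf a).
Proof.
apply: cmeas_ifb; first exact: measurable_fun_ltr.
apply: cmeasM; first exact: cmeas_rpowC.
by apply: cmeas_real; apply: measurableT_comp => //; exact: measurableT_comp.
Qed.

Lemma normc_gammaf a t : 0 < t ->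
  normc (gammaf a t) = expR ((Re a - 1) * ln t - t).
Proof.
move=> t0; rewrite /gammaf t0 Normc.normcM normc_rpowC normc_real.
by rewrite ger0_norm ?expR_ge0// -expRD raddfB.
Qed.

(** With u = t^x the claim amounts to e^(-t) (1 + u)^2 <= K x, and (1 + u)^2 <= 2 (1 + u^2) leaves
    e^(-t) t^(2x) to bound. *)
Lemma gammaf_bound x : 0 < x -> exists2 K : R, 0 <= K & forall t, 0 < t ->
  expR ((x - 1) * ln t - t) <=
  K * ((1 + expR (x * ln t)) ^- 2 * (expR (x * ln t) * (x * t^-1))).
Proof.
(* ln y <= y at y = t / (2x) gives 2x ln t - t <= 2x ln (2x), the exponent [M]. *)
move=> x0; pose M := x *+ 2 * ln (x *+ 2).
exists (2 * (1 + expR M) / x).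
  by rewrite !mulr_ge0 ?invr_ge0 ?ltW// addr_gt0// expR_gt0.
move=> t t0; set u := expR (x * ln t).
have u0 : 0 < u by exact: expR_gt0.
have E1 : expR ((x - 1) * ln t - t) = u * t^-1 * expR (- t).
  by rewrite mulrBl mul1r !expRD (expRN (ln t)) lnK ?posrE.
have B : expR (- t) * u ^+ 2 <= expR M.
  rewrite -expRM_natl -expRD ler_expR.
  have x2 : 0 < x *+ 2 by rewrite mulrn_wgt0.
  have := ltW (ln_sublinear (divr_gt0 t0 x2)).
  rewrite ln_div ?posrE// ler_pdivlMr// /M mulrBl lerBlDr.
  by rewrite mulr2n; lra.
have A : expR (- t) <= 1 by rewrite expR_le1; lra.
have X : expR (- t) * (1 + u) ^+ 2 <= 2 * (1 + expR M).
  have e0 : 0 <= expR (- t) by exact: expR_ge0.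
  have S : (1 + u) ^+ 2 <= 2 * (1 + u ^+ 2).
    by rewrite -subr_ge0 [X in 0 <= X](_ : _ = (1 - u) ^+ 2) ?sqr_ge0//; ring.
  apply: le_trans (ler_wpM2l e0 S) _; rewrite mulrCA ler_wpM2l//.
  by rewrite mulrDr mulr1 lerD.
have v0 : 0 < (1 + u) ^+ 2 by rewrite exprn_gt0// addr_gt0.
rewrite E1 [leRHS](_ : _ =
   u * t^-1 * ((2 * (1 + expR M)) / (1 + u) ^+ 2)); last first.
  by field; rewrite ?gt_eqF// addr_gt0.
rewrite ler_pM2l; last by rewrite mulr_gt0// invr_gt0.
by rewrite ler_pdivlMr.
Qed.

Lemma cintegrable_gammaf a : 0 < Re a -> cintegrable leb setT (gammaf a).
Proof.
move=> a0; apply/cintegrableP; split; first exact: cmeas_gammaf.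
have [K K0 HK] := gammaf_bound a0.
set h : R -> R := fun t => (1 + expR (Re a * ln t)) ^- 2 *
  (expR (Re a * ln t) * (Re a * t^-1)).
have mn : measurable_fun setT (fun t => (normc (gammaf a t))%:E).
  by apply/measurable_EFinP; apply: measurable_normc; exact: cmeas_gammaf.
have -> : (\int[leb]_t (normc (gammaf a t))%:E =
    \int[leb]_(t in `]0%R, +oo[) (normc (gammaf a t))%:E)%E.
  rewrite [RHS]integral_mkcond; apply: eq_integral => t _; rewrite patchE.
  case: ifPn => //; rewrite notin_setE /= in_itv/= andbT => /negP/negbTE t0.
  by rewrite /gammaf t0 Normc.normc0.
have h0 t : 0 < t -> 0 <= h t.
  move=> t0; rewrite /h !mulr_ge0// ?expR_ge0// ?invr_ge0 ?sqr_ge0 ?ltW//.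
have mh : measurable_fun (`]0, +oo[%classic : set R) (fun t => (h t)%:E).
  apply/measurable_EFinP; apply: open_continuous_measurable_fun => // t.
  rewrite inE/= in_itv/= andbT => t0.
  exact/derivable_continuous_at/derivable_inv1DexpRln'.
apply: (@le_lt_trans _ _ (\int[leb]_(t in `]0%R, +oo[) (K%:E * (h t)%:E))%E).
  apply: ge0_le_integral => //.
  - by move=> t _; rewrite lee_fin normc_ge0.
  - exact: measurable_funTS.
  - by apply: emeasurable_funM.
  - move=> t /=; rewrite in_itv/= andbT => t0.
    by rewrite -EFinM lee_fin normc_gammaf// HK.
rewrite ge0_integralZl//; last first.
  by move=> t /=; rewrite in_itv/= andbT => t0; rewrite lee_fin h0.
apply: (@le_lt_trans _ _ (K%:E * 1)%E); last by rewrite mule1 ltry.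
by rewrite lee_wpmul2l// ?lee_fin// integral_inv1DexpRln.
Qed.

Lemma gammaCE a : gammaC a = cintegral leb setT (gammaf a).
Proof.
have E (g : C -> R) : g 0 = 0 ->
    \int[leb]_(t in `]0, +oo[) g (rpowC t (a - 1) * (expR (- t))%:C) =
    \int[leb]_t g (gammaf a t).
  move=> g0; rewrite Rintegral_mkcond; apply: eq_Rintegral => t _.
  rewrite patchE /gammaf mem_setE in_itv/= andbT.
  by case: ifP.
by rewrite /gammaC /cintegral !E.
Qed.

End gamma_integrable.

(** * The functional equation of the gamma function *)

Section gamma_functional_equation.
Context {R : realType}.
Local Notation C := R[i].
Local Notation leb := (@lebesgue_measure R).
Local Notation RR := (measurableTypeR R).
Local Open Scope complex_scope.
Local Notation Re := complex.Re.
Local Notation Im := complex.Im.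
Local Notation normc := Normc.normc.
Implicit Types (x y s t : R) (a : C).

Lemma cintegrable_le d (T : measurableType d) (mu : {measure set T -> \bar R})
    (f g : T -> C) : cmeas f -> cintegrable mu setT g ->
  (forall u, normc (f u) <= normc (g u)) -> cintegrable mu setT f.
Proof.
move=> mf /cintegrableP[mg ig] fg; apply/cintegrableP; split => //.
apply: le_lt_trans ig; apply: ge0_le_integral => //.
- by move=> u _; rewrite lee_fin normc_ge0.
- by apply/measurable_EFinP; exact: measurable_normc.
- by apply/measurable_EFinP; exact: measurable_normc.
- by move=> u _; rewrite lee_fin fg.
Qed.

Lemma is_derive_Re_rpowC s (b : C) : 0 < s ->
  is_derive s 1 (fun s => Re (rpowC s b)) (Re (b * rpowC s (b - 1))).
Proof.
move=> s0; under eq_fun do rewrite Re_rpowC.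
have L := is_derive1_ln s0.
apply: is_derive_eq.
rewrite cReM Re_rpowC Im_rpowC !raddfB/= subr0 /GRing.scale/=.
by rewrite mulrBl mul1r expRD expRN lnK ?posrE//; ring.
Qed.

Lemma is_derive_Im_rpowC s (b : C) : 0 < s ->
  is_derive s 1 (fun s => Im (rpowC s b)) (Im (b * rpowC s (b - 1))).
Proof.
move=> s0; under eq_fun do rewrite Im_rpowC.
have L := is_derive1_ln s0.
apply: is_derive_eq.
rewrite cImM Re_rpowC Im_rpowC !raddfB/= subr0 /GRing.scale/=.
by rewrite mulrBl mul1r expRD expRN lnK ?posrE//; ring.
Qed.

Definition ind12 (s : R) : bool := (1 <= s) && (s <= 2).

Lemma measurable_ind12 : measurable_fun setT ind12.
Proof. by apply: measurable_and; exact: measurable_fun_ler. Qed.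

Lemma cintegrable_ind12 : cintegrable leb setT (fun s => if ind12 s then 1 else 0 : C).
Proof.
apply/cintegrableP; split.
  by apply: cmeas_ifb; [exact: measurable_ind12|exact: cmeas_cst].
rewrite (_ : (\int[leb]_s _)%E = (\int[leb]_(s in `[1%R, 2%R]) (cst 1 s))%E).
  by rewrite integral_cst//= lebesgue_measure_itv/= lte_fin ltr1n mul1e -EFinB ltry.
rewrite [RHS]integral_mkcond; apply: eq_integral => s _.
rewrite patchE mem_setE in_itv/= -/(ind12 s).
by case: ifP; rewrite ?Normc.normc1 ?Normc.normc0.
Qed.

Lemma Rintegral_ind12 (f : R -> R) :
  \int[leb]_s (if ind12 s then f s else 0) = \int[leb]_(s in `[1, 2]) f s.
Proof.
rewrite [RHS]Rintegral_mkcond; apply: eq_Rintegral => s _.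
by rewrite patchE mem_setE in_itv/=.
Qed.

Lemma cintegral_rpowC12 (b : C) :
  cintegral leb setT (fun s => if ind12 s then b * rpowC s (b - 1) else 0) =
  rpowC 2 b - 1.
Proof.
have dB s : 0 < s -> [/\ derivable (fun s => Re (rpowC s (b - 1))) s 1 &
    derivable (fun s => Im (rpowC s (b - 1))) s 1].
  move=> s0; have [? _] := is_derive_Re_rpowC (b - 1) s0.
  by have [? _] := is_derive_Im_rpowC (b - 1) s0.
have d1 s : 0 < s -> derivable (fun s => Re (b * rpowC s (b - 1))) s 1.
  move=> /dB[d e]; under eq_fun do rewrite cReM.
  exact: (derivableB (derivableM (derivable_cst (Re b) s 1) d)
    (derivableM (derivable_cst (Im b) s 1) e)).
have d2 s : 0 < s -> derivable (fun s => Im (b * rpowC s (b - 1))) s 1.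
  move=> /dB[d e]; under eq_fun do rewrite cImM.
  exact: (derivableD (derivableM (derivable_cst (Re b) s 1) e)
    (derivableM (derivable_cst (Im b) s 1) d)).
rewrite /cintegral.
under [X in X +i* _]eq_Rintegral do rewrite (fun_if (@complex.Re R)).
under [X in _ +i* X]eq_Rintegral do rewrite (fun_if (@complex.Im R)).
rewrite !Rintegral_ind12 /Rintegral.
rewrite (FTC_pos _ _ (fun s => @is_derive_Re_rpowC s b) d1) ?ltr1n//.
rewrite (FTC_pos _ _ (fun s => @is_derive_Im_rpowC s b) d2) ?ltr1n//.
by rewrite -(rpow1C b); apply/eqP; rewrite eq_complex !raddfB /= !eqxx.
Qed.

Definition gammafs (s : R) (a : C) (t : R) : C :=
  if 0 < t then rpowC t (a - 1) * (expR (- (s * t)))%:C else 0.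

(** Rescale t by [s]: the weight s and the factor s^(a-1) make s^a, which s^(-a) cancels. *)
Lemma gammafs_integral s a : 0 < s -> 0 < Re a ->
  cintegrable leb setT (gammafs s a) /\
  cintegral leb setT (gammafs s a) = rpowC s (- a) * gammaC a.
Proof.
move=> s0 a0; have H := cov_affine 0 s0.
have E : gammafs s a =
    (fun t => rpowC s (- a) * (gammaf a (s * t + 0) * (cst s t)%:C)).
  apply/funext => t; rewrite /gammafs /gammaf addr0 pmulr_rgt0//.
  case: ifPn => [t0|_]; last by rewrite mul0r mulr0.
  rewrite rpowCM//= -[s%:C]rpowC1//.
  rewrite (_ : rpowC s (- a) * _ = (rpowC s (- a) * (rpowC s (a - 1) * rpowC s 1))
     * (rpowC t (a - 1) * (expR (- (s * t)))%:C)); last by ring.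
  by rewrite -!rpowCD subrK addNr rpowC0 mul1r.
have I : cintegrable leb setT (fun t => gammaf a (s * t + 0) * (cst s t)%:C).
  by apply/(cov_cintegrable H (cmeas_gammaf a)); exact: cintegrable_gammaf.
rewrite E; split; first exact: cintegrableZ.
by rewrite cintegralZ// -(cov_cintegral H (cmeas_gammaf a)) gammaCE.
Qed.

Lemma integral_expR12 t : 0 < t ->
  \int[leb]_(s in `[1, 2]) expR (- (s * t)) = t^-1 * (expR (- t) - expR (- (2 * t))).
Proof.
move=> t0.
have D s : 0 < s -> is_derive s 1 (fun s => - (t^-1 * expR (- (s * t)))) (expR (- (s * t))).
  move=> s0; apply: is_derive_eq; rewrite /GRing.scale/=.
  by field; rewrite gt_eqF.
have D' s : 0 < s -> derivable (fun s => expR (- (s * t))) s 1 by [].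
rewrite /Rintegral (FTC_pos _ _ D D') ?ltr1n//= mul1r; ring.
Qed.

Definition gamma_kernel (a : C) (z : RR * RR) : C :=
  if ind12 z.2 then gammafs z.2 (a + 1) z.1 else 0.

Lemma cmeas_gamma_kernel a : cmeas (gamma_kernel a).
Proof.
apply: cmeas_ifb.
  exact: (measurableT_comp measurable_ind12 measurable_snd).
apply: cmeas_ifb; first by apply: measurable_fun_ltr.
apply: cmeasM; first by apply: cmeas_rpowC.
apply: cmeas_real; apply: measurableT_comp => //; apply: measurableT_comp => //.
exact: measurable_funM.
Qed.

(** As s >= 1, e^(-st) <= e^(-t): the kernel is dominated by the product of [gammaf (a + 1)] and the
    indicator of [1, 2]. *)
Lemma cintegrable_gamma_kernel a : 0 < Re a ->
  cintegrable (sprod leb leb) setT (gamma_kernel a).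
Proof.
move=> a0; have a1 : 0 < Re (a + 1) by rewrite raddfD/= addr_gt0.
have [I _] := cintegral_sprodM (cintegrable_gammaf a1) cintegrable_ind12.
apply: cintegrable_le I _; first exact: cmeas_gamma_kernel.
move=> [t s]; rewrite /gamma_kernel /=.
case: ifPn => [/andP[s1 s2]|_]; last by rewrite Normc.normc0 normc_ge0.
rewrite mulr1 /gammafs /gammaf; case: ifPn => // t0.
rewrite !Normc.normcM ler_wpM2l ?normc_ge0// !normc_real.
by rewrite !ger0_norm ?expR_ge0// ler_expR lerN2 ler_peMl// ltW.
Qed.

(** Evaluate the integral of t^a e^(-st) over t > 0 and 1 <= s <= 2 in both orders. With t first it
    is K Gamma(a+1), where K is the integral of s^(-a-1) over [1, 2] and a K = 1 - 2^(-a). With s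
    first, the inner integral is t^(a-1) (e^(-t) - e^(-2t)), and the total is (1 - 2^(-a)) Gamma(a)
    = a K Gamma(a). *)
Lemma gammaCS a : 0 < Re a -> gammaC (a + 1) = a * gammaC a.
Proof.
move=> a0; have a1 : 0 < Re (a + 1) by rewrite raddfD/= addr_gt0.
(* |2^(-a)| < 1 because Re a > 0; hence [K] is nonzero and can be cancelled at the end. *)
have a2 : 1 - rpowC 2 (- a) != 0.
  rewrite subr_eq0; apply/eqP => /(congr1 (@Normc.normc R)).
  rewrite Normc.normc1 normc_rpowC => /eqP; rewrite eq_sym lt_eqF//.
  by rewrite expR_lt1 raddfN/= mulNr oppr_lt0 mulr_gt0// ln_gt0// ltr1n.
have mk := cmeas_gamma_kernel a.
have I := cintegrable_gamma_kernel a0.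
pose K := cintegral leb setT (fun s => if ind12 s then rpowC s (- (a + 1)) else 0).
have mpow (b : C) : cmeas (fun s : RR => if ind12 s then rpowC s b else 0).
  by apply: cmeas_ifb; [exact: measurable_ind12|exact: cmeas_rpowC].
have Ipow (b : C) : cintegrable leb setT (fun s => if ind12 s then rpowC s b else 0).
  have Z := (cintegrableZ (expR (`|Re b| * ln 2))%:C cintegrable_ind12).
  apply: cintegrable_le (mpow b) Z _ => s; case: ifPn => [/andP[s1 s2]|_]; last first.
    by rewrite Normc.normc0 normc_ge0.
  rewrite mulr1 normc_rpowC normc_real ger0_norm ?expR_ge0// ler_expR.
  have l0 : 0 <= ln s by exact: ln_ge0.
  apply: le_trans (ler_wpM2r l0 (ler_norm _)) _.
  by rewrite ler_wpM2l// ler_ln ?posrE//; exact: lt_le_trans s1.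
have aK : a * K = 1 - rpowC 2 (- a).
  apply: oppr_inj; rewrite opprB -mulNr -cintegral_rpowC12 -cintegralZ//.
  apply: eq_cintegral => s; rewrite opprD.
  by case: ifP => // _; rewrite mulr0.
have E1 : cintegral (sprod leb leb) setT (gamma_kernel a) = K * gammaC (a + 1).
  have sw := @cov_swap R _ _ _ _ leb leb.
  have X : (fun z : RR * RR => gamma_kernel a (z.2, z.1) * (cst 1 z)%:C) =
      (fun z => gamma_kernel a (z.2, z.1)).
    by apply/funext => z; rewrite mulr1.
  rewrite (cov_cintegral sw mk) X.
  have /(cov_cintegrable sw mk) := I; rewrite X => I'.
  have [|_ ->] := cfubini I'.
    move=> s; rewrite /gamma_kernel/=; case E : (ind12 s).
      move/andP: E => [s1 _].
      by have [] := @gammafs_integral s (a + 1) (lt_le_trans ltr01 s1) a1.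
    rewrite (_ : (fun _ => _) = fun t => 0 * gammaf (a + 1) t).
      by apply: cintegrableZ; exact: cintegrable_gammaf.
    by apply/funext => t; rewrite mul0r.
  rewrite mulrC -cintegralZ//; apply: eq_cintegral => s.
  rewrite /gamma_kernel/=; case E : (ind12 s).
    move/andP: E => [s1 _].
    have [_ ->] := @gammafs_integral s (a + 1) (lt_le_trans ltr01 s1) a1.
    by rewrite mulrC.
  rewrite (@eq_cintegral _ _ _ _ _ (fun t : RR => 0 * gammaf (a + 1) t)).
    by rewrite cintegralZ ?mul0r ?mulr0//; exact: cintegrable_gammaf.
  by move=> t; rewrite mul0r.
have E2 : cintegral (sprod leb leb) setT (gamma_kernel a) =
    gammaC a - rpowC 2 (- a) * gammaC a.
  have [|_ ->] := cfubini I.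
    move=> t; rewrite /gamma_kernel /=.
    apply: cintegrable_le (cmeas_comp mk (pair1_measurable t))
      (cintegrableZ (rpowC t a) cintegrable_ind12) _ => s.
    rewrite /gamma_kernel/=; case: ifPn => [/andP[s1 s2]|_]; last by rewrite Normc.normc0 normc_ge0.
    rewrite mulr1 /gammafs addrK; case: ifPn => [t0|_]; last first.
      by rewrite Normc.normc0 normc_ge0.
    rewrite Normc.normcM ler_piMr ?normc_ge0// normc_real ger0_norm ?expR_ge0//.
    by rewrite expR_le1 oppr_le0 mulr_ge0 ?ltW// (lt_le_trans _ s1).
  have [J2 <-] := @gammafs_integral 2 a (ltr0Sn _ _) a0.
  rewrite gammaCE.
  rewrite -[X in _ - X]mul1r -mulNr -cintegralZ// -cintegralD//; last 2 first.
  - exact: cintegrable_gammaf.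
  - exact: cintegrableZ.
  apply: eq_cintegral => t; rewrite mulN1r /gamma_kernel/= /gammafs/gammaf addrK.
  case t0 : (0 < t); last first.
    rewrite subr0 (@eq_cintegral _ _ _ _ _ (fun t : RR => 0 * gammaf a t)).
      by rewrite cintegralZ ?mul0r//; exact: cintegrable_gammaf.
    by move=> s; rewrite mul0r; case: ifP.
  rewrite -mulrBr -rmorphB/=.
  rewrite (@eq_cintegral _ _ _ _ _ (fun s : RR => rpowC t a *
    (if ind12 s then expR (- (s * t)) else 0)%:C)); last first.
    by move=> s; case: ifP; rewrite ?mulr0.
  rewrite cintegralZ; last first.
    apply: cintegrable_le cintegrable_ind12 _.
      apply: cmeas_real; apply: measurable_fun_ifT => //.
      - exact: measurable_ind12.
      - apply: measurableT_comp => //; apply: measurableT_comp => //.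
        exact: measurable_funM.
    move=> s; case: ifPn => [/andP[s1 _]|_]; last by rewrite Normc.normc0.
    rewrite Normc.normc1 normc_real ger0_norm ?expR_ge0//.
    by rewrite expR_le1 oppr_le0 mulr_ge0 ?ltW// (lt_le_trans _ s1).
  rewrite (_ : cintegral _ _ _ = (t^-1 * (expR (- t) - expR (- (2 * t))))%:C).
    rewrite rmorphM mulrA; congr (_ * _).
    have -> : rpowC t a = rpowC t (a - 1) * t%:C.
      by rewrite -[t%:C]rpowC1// -rpowCD subrK.
    by rewrite -mulrA -rmorphM mulfV ?gt_eqF// mulr1.
  rewrite /cintegral -integral_expR12// -Rintegral_ind12/=.
  apply/eqP; rewrite eq_complex/= eqxx/=; apply/eqP.
  by rewrite -[LHS]/(\int[leb]_s 0) /Rintegral integral0.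
have : K * (gammaC (a + 1) - a * gammaC a) = 0.
  by rewrite mulrBr -E1 E2 mulrA (mulrC K) aK; ring.
move/eqP; rewrite mulf_eq0 subr_eq0 => /orP[/eqP K0|/eqP//].
by move: a2; rewrite -aK K0 mulr0 eqxx.
Qed.

End gamma_functional_equation.

(** * The gamma function has no zeros *)

Section gamma_nonvanishing.
Context {R : realType}.
Local Notation C := R[i].
Local Notation leb := (@lebesgue_measure R).
Local Notation RR := (measurableTypeR R).
Local Open Scope complex_scope.
Local Notation Re := complex.Re.
Local Notation Im := complex.Im.
Local Notation normc := Normc.normc.
Implicit Types (x y s t r : R) (a z : C).

(** 1 - cos t = 2 sin(t/2)^2, and |sin s| <= s for s >= 0 by the mean value theorem. *)
Lemma cos_ge1Bsqr t : 1 - t ^+ 2 / 2 <= cos t.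
Proof.
have sin_le s : 0 <= s -> `|sin s| <= s.
  move=> s0; have [c _ E] := @MVT_segment R sin cos 0 s s0
    (fun u _ => is_derive_sin u) (continuous_subspaceT (@continuous_sin R)).
  move: E; rewrite sin0 !subr0 => ->.
  by rewrite normrM [X in _ * X]ger0_norm// ler_piMl// cos_max.
rewrite -cos_norm -real_normK ?num_real//; set u := `|t|.
rewrite (_ : u = (u / 2) *+ 2) ?cos_mulr2n; last by rewrite -mulr_natr divfK.
rewrite cos2sin2 -(mulr_natr (u / 2)) divfK//.
have u0 : 0 <= u / 2 by rewrite divr_ge0// normr_ge0.
have := sin_le _ u0; rewrite -(ler_pXn2r (ltn0Sn 1)) ?nnegrE// real_normK ?num_real//.
rewrite expr_div_n; lra.
Qed.

(** With v = e^(t/2) the right side is 4 (v - 1/v)^2, and 1 + u <= e^u at u = t/2 and u = -t/2 gives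
    |t/2| <= |v - 1/v|. For t a shifted logarithm the exponentials only move the parameter of a
    gamma integral, so they integrate exactly. *)
Lemma sqr_le_expR t : t ^+ 2 <= 4 * (expR t - 2 + expR (- t)).
Proof.
pose v := expR (t / 2); have v0 : 0 < v := expR_gt0 _.
have vE : expR t = v ^+ 2 by rewrite -expRM_natl mulrC divfK.
have wE : expR (- t) = v^-1 ^+ 2 by rewrite expRN vE exprVn.
have H1 : t / 2 <= v - 1 by rewrite lerBrDl expR_ge1Dx.
have H2 : 1 - v^-1 <= t / 2.
  by have := expR_ge1Dx (- (t / 2)); rewrite expRN -/v; lra.
have vv : v * v^-1 = 1 by rewrite mulfV ?gt_eqF.
have w0 : 0 < v^-1 by rewrite invr_gt0.
rewrite vE wE; set w := v^-1 in H2 vv w0 *.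
have -> : v ^+ 2 - 2 + w ^+ 2 = (v - w) ^+ 2 by rewrite sqrrB vv.
have -> : t ^+ 2 = 4 * (t / 2) ^+ 2 by field.
rewrite ler_pM2l// -ler_sqrt ?sqr_ge0// !sqrtr_sqr.
have [v1|v1] := leP 1 v.
  have w1 : w <= 1 by rewrite /w invf_le1.
  rewrite ger0_norm; last by apply: le_trans H2; rewrite subr_ge0.
  rewrite ger0_norm; last by rewrite subr_ge0 (le_trans w1).
  by apply: le_trans H1 _; rewrite lerD2l lerN2.
have w1 : 1 < w by rewrite /w invf_gt1.
rewrite ler0_norm; last by apply: le_trans H1 _; rewrite subr_le0 ltW.
rewrite ler0_norm; last by rewrite subr_le0 ltW// (lt_trans v1).
by rewrite lerN2; apply: le_trans _ H2; rewrite lerB// ltW.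
Qed.

Definition rgammaf (x t : R) : R :=
  if 0 < t then expR ((x - 1) * ln t - t) else 0.

Lemma gammaf_real x t : gammaf x%:C t = (rgammaf x t)%:C.
Proof.
rewrite /gammaf /rgammaf; case: ifP => // t0.
by rewrite -[1]/(1%:C) -rmorphB rpowC_real -rmorphM -expRD.
Qed.

Definition rgamma x : R := \int[leb]_t rgammaf x t.

Lemma gammaC_real x : gammaC x%:C = (rgamma x)%:C.
Proof.
rewrite gammaCE (@eq_cintegral _ _ _ _ _ (fun t : RR => (rgammaf x t)%:C)).
  rewrite /cintegral; apply/eqP; rewrite eq_complex/= eqxx/=; apply/eqP.
  by rewrite /Rintegral integral0.
by move=> t; rewrite gammaf_real.
Qed.

Lemma rgammaS x : 0 < x -> rgamma (x + 1) = x * rgamma x.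
Proof.
move=> x0; have := @gammaCS _ x%:C x0.
rewrite -[1]/(1%:C) -rmorphD !gammaC_real -rmorphM => /(congr1 (@complex.Re R)).
by [].
Qed.

Lemma integrable_rgammaf x : 0 < x -> leb.-integrable setT (fun t => (rgammaf x t)%:E).
Proof.
move=> x0; have [+ _] := @cintegrable_gammaf _ x%:C x0.
by under eq_fun do rewrite gammaf_real.
Qed.

(** On [1, 2] the integrand is at least e^(-2), as (x - 1) ln t >= 0 there. *)
Lemma rgamma_gt0 x : 1 <= x -> 0 < rgamma x.
Proof.
move=> x1; have x0 := lt_le_trans ltr01 x1.
have [I _] := @cintegrable_ind12 R.
apply: (@lt_le_trans _ _ (\int[leb]_t (expR (- 2) * Re (if ind12 t then 1 else 0 : C)))).
  rewrite RintegralZl//= mulr_gt0 ?expR_gt0//.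
  under eq_Rintegral do rewrite (fun_if (@complex.Re R)).
  rewrite Rintegral_ind12 Rintegral_cst//= lebesgue_measure_itv/= lte_fin ltr1n/=.
  lra.
apply: le_Rintegral => //.
- rewrite (_ : _ \o _ = fun t => (expR (- 2))%:E * (Re (if ind12 t then 1 else 0 : C))%:E)%E.
    exact: integrableZl.
  by apply/funext => t; rewrite -EFinM.
- exact: integrable_rgammaf.
- move=> t _; rewrite /rgammaf; case: ifPn => [/andP[t1 t2]|_]; last first.
    by rewrite mulr0; case: ifP => // _; exact: expR_ge0.
  rewrite (lt_le_trans ltr01 t1) mulr1 ler_expR.
  have : 0 <= (x - 1) * ln t by rewrite mulr_ge0 ?subr_ge0 ?ln_ge0.
  lra.
Qed.

(* Under the Gamma(x) distribution, log t concentrates at log x as x grows, so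
   the phase t^(iy) cannot average to zero. *)
Lemma gammaC_neq0_large x y : 1 + 2 * y ^+ 2 < x -> gammaC (x +i* y) != 0.
Proof.
move=> xy; have x1 : 1 < x by apply: le_lt_trans xy; rewrite lerDl mulr_ge0// sqr_ge0.
have x0 : 0 < x by rewrite (lt_trans ltr01).
apply/eqP => G0.
have a0 : 0 < Re (x +i* y) by [].
have Ia := cintegrable_gammaf a0.
(* The constant phase x^(-iy) centres the oscillation at t = x: the real part becomes [rgammaf x t]
   times cos(y (ln t - ln x)). *)
pose u := rpowC x (0 -i* y).
have [Iu _] := cintegrableZ u Ia.
have Eu : \int[leb]_t Re (u * gammaf (x +i* y) t) = 0.
  have := cintegralZ u Ia; rewrite -gammaCE G0 mulr0.
  by move=> /(congr1 (@complex.Re R)).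
have uE t : Re (u * gammaf (x +i* y) t) =
    rgammaf x t * cos (y * (ln t - ln x)).
  rewrite /gammaf /rgammaf; case: ifPn => t0; last by rewrite mulr0 mul0r.
  rewrite /u mulrA.
  have -> (z : C) r : Re (z * r%:C) = Re z * r by rewrite cReM /= mulr0 subr0.
  rewrite cReM !Re_rpowC !Im_rpowC !raddfB/= mul0r expR0.
  rewrite subr0 expRD !mul1r mulNr cosN sinN.
  by rewrite mulrBr cosB; ring.
(* Passing from [x] to [x + 1] or [x - 1] multiplies [rgammaf] by t or 1/t. So with l = ln t - ln x,
   for t > 0, [L t] is [rgammaf x t] times 1 - 2 y^2 (e^l - 2 + e^(-l)), a lower bound of cos(y l)
   by [cos_ge1Bsqr] and [sqr_le_expR]. *)
pose L t := rgammaf x t - 2 * y ^+ 2 *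
  (rgammaf (x + 1) t / x - 2 * rgammaf x t + x * rgammaf (x - 1) t).
have LE t : L t <= Re (u * gammaf (x +i* y) t).
  rewrite uE /L; have [t0|t0] := ltP 0 t; last first.
    by rewrite /rgammaf ltNge t0/= !(mulr0,mul0r,subr0,addr0).
  have ET (v : R) : rgammaf (v + 1) t = rgammaf v t * t.
    rewrite /rgammaf t0; have <- : expR (ln t) = t by rewrite lnK.
    by rewrite expRK -expRD; congr expR; ring.
  have E1 : rgammaf (x + 1) t / x = rgammaf x t * expR (ln t - ln x).
    by rewrite ET expRB !lnK ?posrE// mulrA.
  have E2 : x * rgammaf (x - 1) t = rgammaf x t * expR (- (ln t - ln x)).
    rewrite -[in rgammaf x t](subrK 1 x) ET opprB expRB !lnK ?posrE//.
    by field; rewrite gt_eqF.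
  rewrite E1 E2; set l := ln t - ln x.
  have g0 : 0 <= rgammaf x t by rewrite /rgammaf t0 expR_ge0.
  rewrite [leLHS](_ : _ = rgammaf x t *
    (1 - 2 * y ^+ 2 * (expR l - 2 + expR (- l)))); last by ring.
  rewrite ler_wpM2l//; apply: le_trans (cos_ge1Bsqr _).
  rewrite lerD2l lerN2 exprMn.
  have := ler_wpM2l (sqr_ge0 y) (sqr_le_expR l).
  set e := expR l - 2 + _; lra.
have IZ (c : R) (f : R -> R) : leb.-integrable setT (fun t => (f t)%:E) ->
    leb.-integrable setT (fun t => (c * f t)%:E).
  by move=> If; under eq_fun do rewrite EFinM; exact: integrableZl.
have ID (f g : R -> R) : leb.-integrable setT (fun t => (f t)%:E) ->
    leb.-integrable setT (fun t => (g t)%:E) ->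
    leb.-integrable setT (fun t => (f t + g t)%:E).
  by move=> If Ig; under eq_fun do rewrite EFinD; exact: integrableD.
have I0 := integrable_rgammaf x0.
have I1 : leb.-integrable setT (fun t => (rgammaf (x + 1) t)%:E).
  by apply: integrable_rgammaf; rewrite addr_gt0.
have I2 : leb.-integrable setT (fun t => (rgammaf (x - 1) t)%:E).
  by apply: integrable_rgammaf; rewrite subr_gt0.
pose c := 2 * y ^+ 2.
have LF : L = fun t => (1 + 2 * c) * rgammaf x t +
    (- c / x * rgammaf (x + 1) t + - (c * x) * rgammaf (x - 1) t).
  by apply/funext => t; rewrite /L /c; ring.
have IL : \int[leb]_t L t = (1 + 2 * c) * rgamma x +
    (- c / x * rgamma (x + 1) + - (c * x) * rgamma (x - 1)).
  rewrite LF RintegralD//; [|exact: IZ|exact: (ID _ _ (IZ _ _ I1) (IZ _ _ I2))].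
  rewrite RintegralD//; [|exact: IZ|exact: IZ].
  by rewrite !RintegralZl.
have IL' : leb.-integrable setT (EFin \o L).
  by rewrite LF; exact: (ID _ _ (IZ _ _ I0) (ID _ _ (IZ _ _ I1) (IZ _ _ I2))).
have := @le_Rintegral _ _ _ leb setT L _ measurableT IL' Iu (fun t _ => LE t).
rewrite Eu IL rgammaS//.
have Gx : rgamma x = (x - 1) * rgamma (x - 1).
  by rewrite -rgammaS ?subr_gt0// subrK.
have G1 : 0 < rgamma x by apply: rgamma_gt0; exact: ltW.
have x10 : 0 < x - 1 by rewrite subr_gt0.
have -> : rgamma (x - 1) = rgamma x / (x - 1).
  by rewrite Gx mulrAC mulfV ?mul1r// gt_eqF.
(* The bracket in [L] integrates to Gamma(x) (1 - 2 + x/(x - 1)) = Gamma(x)/(x - 1), which leaves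
   Gamma(x) (1 - c/(x - 1)). The hypothesis on [x] makes this positive, whereas the vanishing of
   gamma bounds it by 0. *)
rewrite [leLHS](_ : _ = rgamma x * ((x - 1 - c) / (x - 1))); last first.
  by field; rewrite !gt_eqF.
by rewrite leNgt mulr_gt0// divr_gt0// subr_gt0 ltrBrDl.
Qed.

(** By the functional equation a zero at [a] gives zeros at all a + n, with the same imaginary part
    and a real part eventually beyond the bound of [gammaC_neq0_large]. *)
Lemma gammaC_neq0 a : 0 < Re a -> gammaC a != 0.
Proof.
move=> a0; apply/eqP => G0.
have H n : gammaC (a + n%:R) = 0.
  elim: n => [|n ih]; first by rewrite addr0.
  rewrite -natr1 addrA gammaCS ?ih ?mulr0//.
  by rewrite raddfD/= ltr_pwDl// raddfMn/= ler0n.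
pose n := (Num.truncn (1 + 2 * (Im a) ^+ 2)).+1.
have K : 1 + 2 * (Im a) ^+ 2 < Re a + n%:R.
  by apply: lt_le_trans (truncnS_gt _) _; rewrite lerDr ltW.
have := gammaC_neq0_large K.
rewrite (_ : _ +i* _ = a + n%:R) ?H ?eqxx//.
by apply/eqP; rewrite eq_complex !raddfD/= !raddfMn/= mul0rn addr0 !eqxx.
Qed.

End gamma_nonvanishing.

(** * Positive definite matrices *)

Section hermitian_matrices.
Context {R : realType}.
Local Notation C := R[i].
Local Open Scope complex_scope.
Local Notation Re := complex.Re.
Local Notation Im := complex.Im.
Local Notation normc := Normc.normc.

Definition adjmx m n (M : 'M[C]_(m, n)) : 'M[C]_(n, m) := map_mx Num.conj M^T.

Lemma adjmxE m n (M : 'M[C]_(m, n)) i j : adjmx M i j = Num.conj (M j i).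
Proof. by rewrite !mxE. Qed.

Lemma adjmxK m n : cancel (@adjmx m n) (@adjmx n m).
Proof. by move=> M; apply/matrixP => i j; rewrite !adjmxE conjCK. Qed.

Lemma adjmxD m n (M N : 'M[C]_(m, n)) : adjmx (M + N) = adjmx M + adjmx N.
Proof. by rewrite /adjmx raddfD map_mxD. Qed.

Lemma adjmxN m n (M : 'M[C]_(m, n)) : adjmx (- M) = - adjmx M.
Proof. by rewrite /adjmx raddfN map_mxN. Qed.

Lemma adjmxM m n p (M : 'M[C]_(m, n)) (N : 'M[C]_(n, p)) :
  adjmx (M *m N) = adjmx N *m adjmx M.
Proof. by rewrite /adjmx trmx_mul map_mxM. Qed.

Lemma adjmx1 n : adjmx (1%:M : 'M[C]_n) = 1%:M.
Proof. by rewrite /adjmx trmx1 map_mx1. Qed.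

Lemma adjmxZ_real m n (r : R) (M : 'M[C]_(m, n)) :
  adjmx (r%:C *: M) = r%:C *: adjmx M.
Proof.
apply/matrixP => i j; rewrite !(adjmxE, mxE) rmorphM/=; congr (_ * _).
by rewrite -[LHS]/((r%:C)^*)%C conjc_real.
Qed.

Lemma conj_real (r : R) : Num.conj (r%:C : C) = r%:C.
Proof. by rewrite -[LHS]/((r%:C)^*)%C conjc_real. Qed.

Lemma det_adjmx n (M : 'M[C]_n) : \det (adjmx M) = Num.conj (\det M).
Proof. by rewrite /adjmx det_map_mx det_tr. Qed.

Lemma hermsymmxP n (M : 'M[C]_n) : reflect (M = adjmx M) (M \is hermsymmx).
Proof.
by apply: (iffP (is_hermitianmxP _ _ _)); rewrite expr0 scale1r => {1}->.
Qed.

Lemma ltc0E (z : C) : (0 < z) = (Im z == 0) && (0 < Re z).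
Proof. by rewrite ltcE/=. Qed.

Lemma posdefmx_congr n (L X : 'M[C]_n) : L \in unitmx ->
  posdefmx X -> posdefmx (L *m X *m adjmx L).
Proof.
move=> uL [/hermsymmxP hX pX]; split.
  by apply/hermsymmxP; rewrite !adjmxM adjmxK -hX mulmxA.
move=> v v0.
have -> : v *m (L *m X *m adjmx L) *m map_mx Num.conj v^T =
    (v *m L) *m X *m map_mx Num.conj (v *m L)^T.
  by rewrite -[map_mx _ (v *m L)^T]/(adjmx (v *m L)) adjmxM !mulmxA.
apply: pX; apply: contra v0 => /eqP vL.
by rewrite -[v](mulmxK uL) vL mul0mx.
Qed.

Lemma posdefmx_congrE n (L X : 'M[C]_n) : L \in unitmx ->
  posdefmx (L *m X *m adjmx L) <-> posdefmx X.
Proof.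
move=> uL; split; last exact: posdefmx_congr.
move=> H; have uV : invmx L \in unitmx by rewrite unitmx_inv.
have := posdefmx_congr uV H.
by rewrite -!mulmxA -adjmxM mulVmx// adjmx1 mulmx1 mulKmx.
Qed.

Lemma posdefmxD n (X Y : 'M[C]_n) : posdefmx X -> posdefmx Y -> posdefmx (X + Y).
Proof.
move=> [/hermsymmxP hX pX] [/hermsymmxP hY pY]; split.
  by apply/hermsymmxP; rewrite adjmxD -hX -hY.
move=> v v0; rewrite mulmxDr mulmxDl mxE.
by rewrite addr_gt0 ?pX ?pY.
Qed.

Lemma posdefmx_det n (X : 'M[C]_n) : posdefmx X -> \det X != 0.
Proof.
move=> [_ pX]; apply/negP => /det0P[v v0 vX].
by have := pX v v0; rewrite vX mul0mx mxE ltxx.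
Qed.

Lemma absdet_gt0 n (X : 'M[C]_n) : \det X != 0 -> 0 < absdet X.
Proof.
move=> d0; rewrite lt_def normc_ge0 andbT; apply: contra d0 => /eqP.
by move=> /Normc.eq0_normc ->.
Qed.

Lemma absdetM n (X Y : 'M[C]_n) : absdet (X *m Y) = absdet X * absdet Y.
Proof. by rewrite /absdet det_mulmx Normc.normcM. Qed.

Lemma normc_conj (z : C) : normc (Num.conj z) = normc z.
Proof. by case: z => a b /=; rewrite sqrrN. Qed.

Lemma absdet_adj n (X : 'M[C]_n) : absdet (adjmx X) = absdet X.
Proof. by rewrite /absdet det_adjmx normc_conj. Qed.

Section coordinates.
Variable p : nat.

(** Records the entries on and above the diagonal, with real parts on the diagonal; these describe
    [M] when it is Hermitian. *)
Definition hcoord (M : 'M[C]_p) : hermcoord R p :=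
  [tuple [tuple (if (i <= j)%N then Re (M i j) else Im (M j i)) | j < p] | i < p].

Lemma hermmx_of_herm (c : hermcoord R p) : adjmx (hermmx_of c) = hermmx_of c.
Proof.
apply/matrixP => i j; rewrite adjmxE !mxE.
have [->|ij] := eqVneq i j; first by rewrite conj_real.
have [ij'|ij'|/val_inj ij'] := ltngtP i j.
- by rewrite -[LHS]/(conjc _) /= opprK.
- by [].
- by rewrite ij' eqxx in ij.
Qed.

Lemma hcoordK (M : 'M[C]_p) : adjmx M = M -> hermmx_of (hcoord M) = M.
Proof.
move=> hM; apply/matrixP => i j; rewrite /hcoord !mxE /= !tnth_mktuple.
have H k l : M k l = Num.conj (M l k) by rewrite -{1}hM adjmxE.
have [<-|ij] := eqVneq i j.
  rewrite leqnn; have := H i i; case: (M i i) => a b [/eqP].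
  by rewrite -subr_eq0 opprK -mulr2n mulrn_eq0/= => /eqP->.
have [ij'|ij'|/val_inj ij'] := ltngtP i j.
- by case: (M i j).
- by rewrite (H i j); case: (M j i).
- by rewrite ij' eqxx in ij.
Qed.

Lemma hermmx_of_haff (b c : hermcoord R p) :
  hermmx_of (haff b c) = hermmx_of c + hermmx_of b.
Proof.
apply/matrixP => i j; rewrite /haff /taff !mxE /= !tnth_mktuple !mul1r.
case: eqP => [_|_]; first by rewrite -rmorphD.
by case: ifP => _; apply/eqP; rewrite eq_complex/= ?opprD !eqxx.
Qed.

End coordinates.

Section measurable_matrices.
Context d (T : measurableType d).

Definition mxmeas m n (M : T -> 'M[C]_(m, n)) := forall i j, cmeas (fun t => M t i j).

Lemma mxmeas_cst m n (M : 'M[C]_(m, n)) : mxmeas (fun=> M).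
Proof. by move=> i j; exact: cmeas_cst. Qed.

Lemma mxmeasD m n (M N : T -> 'M[C]_(m, n)) : mxmeas M -> mxmeas N ->
  mxmeas (fun t => M t + N t).
Proof. by move=> mM mN i j; under eq_fun do rewrite mxE; exact: cmeasD. Qed.

Lemma mxmeasN m n (M : T -> 'M[C]_(m, n)) : mxmeas M -> mxmeas (fun t => - M t).
Proof. by move=> mM i j; under eq_fun do rewrite mxE; exact: cmeasN. Qed.

Lemma mxmeasB m n (M N : T -> 'M[C]_(m, n)) : mxmeas M -> mxmeas N ->
  mxmeas (fun t => M t - N t).
Proof. by move=> mM mN; apply: mxmeasD => //; exact: mxmeasN. Qed.

Lemma mxmeasM m n p (M : T -> 'M[C]_(m, n)) (N : T -> 'M[C]_(n, p)) :
  mxmeas M -> mxmeas N -> mxmeas (fun t => M t *m N t).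
Proof.
move=> mM mN i j; under eq_fun do rewrite mxE.
by apply: cmeas_sum => k; exact: cmeasM.
Qed.

Lemma mxmeas_adj m n (M : T -> 'M[C]_(m, n)) : mxmeas M ->
  mxmeas (fun t => adjmx (M t)).
Proof. by move=> mM i j; under eq_fun do rewrite adjmxE; exact: cmeas_conj. Qed.

Lemma mxmeas_sum (I : Type) (s : seq I) m n (F : I -> T -> 'M[C]_(m, n)) :
  (forall i, mxmeas (F i)) -> mxmeas (fun t => \sum_(i <- s) F i t).
Proof.
move=> H i j; under eq_fun do rewrite summxE.
by apply: cmeas_sum => k; exact: H.
Qed.

Lemma cmeas_det n (M : T -> 'M[C]_n) : mxmeas M -> cmeas (fun t => \det (M t)).
Proof.
move=> mM; rewrite /determinant; apply: cmeas_sum => s.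
by apply: cmeasM; [exact: cmeas_cst|apply: cmeas_prod => i; exact: mM].
Qed.

Lemma measurable_absdet n (M : T -> 'M[C]_n) : mxmeas M ->
  measurable_fun setT (fun t => absdet (M t)).
Proof. by move=> mM; apply: measurable_normc; exact: cmeas_det. Qed.

Lemma measurable_hermcoord p (f : T -> hermcoord R p) :
  (forall i j, measurable_fun setT (fun t => tnth (tnth (f t) i) j)) ->
  measurable_fun setT f.
Proof.
move=> H; apply/measurable_fun_tnthP => i; apply/measurable_fun_tnthP => j.
exact: H.
Qed.

Lemma measurable_hcoord p (M : T -> 'M[C]_p) : mxmeas M ->
  measurable_fun setT (fun t => hcoord (M t)).
Proof.
move=> mM; apply: measurable_hermcoord => i j.
under eq_fun do rewrite /hcoord !tnth_mktuple.
by case: (i <= j)%N; [exact: (mM i j).1|exact: (mM j i).2].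
Qed.

Lemma mxmeas_hermmx_of p (f : T -> hermcoord R p) : measurable_fun setT f ->
  mxmeas (fun t => hermmx_of (f t)).
Proof.
move=> mf i j.
have mt k l : measurable_fun setT (fun t => tnth (tnth (f t) k) l).
  apply: (measurableT_comp (measurable_tnth l)).
  exact: (measurableT_comp (measurable_tnth k) mf).
under eq_fun do rewrite !mxE /=.
case: (i == j); first exact: (cmeas_real (mt i i)).
case: (i < j)%N; split => /=; try exact: mt.
exact: measurableT_comp.
Qed.

End measurable_matrices.

End hermitian_matrices.

(** * Schur complements *)

Section schur_coordinates.
Context {R : realType}.
Local Notation C := R[i].
Local Notation leb := (@lebesgue_measure R).
Local Notation RR := (measurableTypeR R).
Local Open Scope complex_scope.
Local Notation Re := complex.Re.
Local Notation Im := complex.Im.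

Definition rowv p (v : p.-tuple RR * p.-tuple RR) : 'rV[C]_p :=
  \row_j ((tnth v.1 j : R) +i* (tnth v.2 j : R)).

Lemma tnth_cons_pair0 d (T : measurableType d) n (z : T * n.-tuple T) :
  tnth (cons_pair z) ord0 = z.1.
Proof. by case: z. Qed.

Lemma tnth_cons_pairS d (T : measurableType d) n (z : T * n.-tuple T) i :
  tnth (cons_pair z) (lift ord0 i) = tnth z.2 i.
Proof. by case: z => x t; rewrite tnthS. Qed.

Lemma hermmx_of_hglue p
    (z : RR * ((p.-tuple RR * p.-tuple RR) * p.-tuple (p.-tuple RR))) :
  hermmx_of (hglue z) = block_mx ((z.1 : R)%:C)%:M (rowv z.2.1)
    (adjmx (rowv z.2.1)) (hermmx_of z.2.2) :> 'M[C]_(1 + p).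
Proof.
have T00 : tnth (tnth (hglue z) ord0) ord0 = z.1.
  by rewrite /hglue !tnth_cons_pair0.
have T0S i : tnth (tnth (hglue z) ord0) (lift ord0 i) = tnth z.2.1.1 i.
  by rewrite /hglue tnth_cons_pair0 tnth_cons_pairS.
have TS i : tnth (hglue z) (lift ord0 i) = cons_pair (tnth z.2.1.2 i, tnth z.2.2 i).
  by rewrite /hglue tnth_cons_pairS /zipcons tnth_mktuple.
have l0 : ord0 = lshift p (0 : 'I_1) by apply: val_inj.
have lS (i : 'I_p) : lift ord0 i = rshift 1 i by apply: val_inj.
apply/matrixP => i j.
have [i' ->|->] := unliftP ord0 i; have [j' ->|->] := unliftP ord0 j.
- rewrite [in RHS]lS [in RHS]lS block_mxEdr !mxE; cbv beta zeta.
  rewrite !TS !tnth_cons_pairS (inj_eq lift_inj).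
  by rewrite /= /bump !leq0n !add1n ltnS.
- rewrite [in RHS]lS [in RHS]l0 block_mxEdl !mxE; cbv beta zeta.
  by rewrite !TS !T0S tnth_cons_pair0.
- rewrite [in RHS]lS [in RHS]l0 block_mxEur !mxE; cbv beta zeta.
  by rewrite !TS !T0S tnth_cons_pair0.
- rewrite [in RHS]l0 block_mxEul !mxE; cbv beta zeta.
  by rewrite T00 eqxx.
Qed.

(* Square root of x for 0 < x; it is 1 for x <= 0, where ln x = 0. *)
Definition rpos (x : R) : R := expR (ln x / 2).

Lemma rpos_gt0 x : 0 < rpos x. Proof. exact: expR_gt0. Qed.

Lemma sqr_rpos x : 0 < x -> rpos x ^+ 2 = x.
Proof. by move=> x0; rewrite /rpos -expRM_natl mulrC divfK// lnK. Qed.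

Lemma measurable_rpos : measurable_fun setT (rpos : RR -> RR).
Proof.
apply: measurableT_comp => //; apply: measurable_funM => //.
Qed.

(** For x > 0, [Y] is the Schur complement of the corner x. The border is sqrt x times v, so that
    the correction to [Y] is [adjmx v *m v] with no division by x. *)
Definition Phi p (x : R) (v : 'rV[C]_p) (Y : 'M[C]_p) : 'M[C]_(1 + p) :=
  block_mx (x%:C)%:M ((rpos x)%:C *: v) (adjmx ((rpos x)%:C *: v))
    (Y + adjmx v *m v).

Definition lowerblock p (r : R) (w : 'cV[C]_p) (L : 'M[C]_p) : 'M[C]_(1 + p) :=
  block_mx (r%:C)%:M 0 w L.

Lemma adj_lowerblock p (r : R) (w : 'cV[C]_p) (L : 'M[C]_p) :
  adjmx (lowerblock r w L) = block_mx (r%:C)%:M (adjmx w) 0 (adjmx L).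
Proof.
rewrite /adjmx tr_block_mx map_block_mx tr_scalar_mx map_scalar_mx trmx0 map_mx0.
by rewrite /= conj_real.
Qed.

Lemma PhiE p (x : R) (v : 'rV[C]_p) (Y : 'M[C]_p) : 0 < x ->
  Phi x v Y = lowerblock (rpos x) (adjmx v) 1%:M *m block_mx 1%:M 0 0 Y *m
    adjmx (lowerblock (rpos x) (adjmx v) 1%:M).
Proof.
move=> x0; rewrite adj_lowerblock /lowerblock !mulmx_block adjmx1 adjmxK.
rewrite !(mulmx0, mul0mx, mulmx1, mul1mx, addr0, add0r).
rewrite !mul_scalar_mx mul_mx_scalar /Phi adjmxZ_real addrC; congr block_mx.
by rewrite scale_scalar_mx -rmorphM -expr2 sqr_rpos.
Qed.

Lemma posdefmx_block1 p (Y : 'M[C]_p) :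
  posdefmx (block_mx 1%:M 0 0 Y : 'M[C]_(1 + p)) <-> posdefmx Y.
Proof.
have adjE : adjmx (block_mx 1%:M 0 0 Y : 'M[C]_(1 + p)) = block_mx 1%:M 0 0 (adjmx Y).
  by rewrite /adjmx tr_block_mx map_block_mx !trmx0 !map_mx0 trmx1 map_mx1.
have qE (u : 'rV[C]_1) (v : 'rV[C]_p) :
    row_mx u v *m block_mx 1%:M 0 0 Y *m map_mx Num.conj (row_mx u v)^T =
    u *m map_mx Num.conj u^T + v *m Y *m map_mx Num.conj v^T.
  rewrite mul_row_block !(mulmx0, addr0, add0r, mulmx1).
  by rewrite tr_row_mx map_col_mx mul_row_col.
have u0 (u : 'rV[C]_1) : (u *m map_mx Num.conj u^T) 0 0 = u 0 0 * Num.conj (u 0 0).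
  by rewrite mxE big_ord1 !mxE.
split=> [[/hermsymmxP h P]|[/hermsymmxP h P]]; split.
- apply/hermsymmxP; move: h; rewrite adjE => /(congr1 drsubmx).
  by rewrite !block_mxKdr.
- move=> v v0; have := P (row_mx 0 v).
  rewrite qE mxE u0 mxE mul0r add0r; apply.
  by apply: contra v0; rewrite row_mx_eq0 => /andP[].
- by apply/hermsymmxP; rewrite adjE -h.
- move=> v; rewrite -[v]hsubmxK row_mx_eq0 qE mxE u0.
  have [->|v0 _] := eqVneq (rsubmx v) 0.
    rewrite andbT mul0mx mul0mx [X in _ + X]mxE addr0 => u1.
    rewrite mul_conjC_gt0; apply: contra u1 => /eqP z.
    by apply/eqP/rowP => i; rewrite (ord1 i) z mxE.
  by rewrite ltr_wpDl ?mul_conjC_ge0// P.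
Qed.

Lemma posdefmx_diag n (X : 'M[C]_n) i : posdefmx X -> 0 < X i i.
Proof.
move=> [_ P]; have := P (delta_mx 0 i).
have -> : map_mx Num.conj (delta_mx 0 i : 'rV[C]_n)^T = delta_mx i 0.
  by rewrite trmx_delta map_delta_mx.
rewrite -rowE -colE !mxE; apply.
by apply/negP => /eqP/matrixP/(_ 0 i)/eqP; rewrite !mxE !eqxx oner_eq0.
Qed.

Lemma unitmx_lowerblock p (r : R) (w : 'cV[C]_p) (L : 'M[C]_p) : 0 < r ->
  L \in unitmx -> lowerblock r w L \in unitmx.
Proof.
move=> r0; rewrite !unitmxE det_lblock det_scalar1 !unitfE => uL.
rewrite mulf_neq0//; apply/eqP => /(congr1 (@complex.Re R)) /= E.
by rewrite E ltxx in r0.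
Qed.

(** For x > 0, [Phi x v Y] is congruent to diag(1, Y). In the forward direction x > 0 is read off
    the corner entry before [PhiE] applies. *)
Lemma posdefmx_Phi p (x : R) (v : 'rV[C]_p) (Y : 'M[C]_p) :
  posdefmx (Phi x v Y) <-> 0 < x /\ posdefmx Y.
Proof.
have uL : lowerblock (rpos x) (adjmx v) 1%:M \in unitmx.
  by apply: unitmx_lowerblock; [exact: rpos_gt0|exact: unitmx1].
split=> [P|[x0 P]]; last first.
  by rewrite PhiE//; apply/posdefmx_congrE => //; apply/posdefmx_block1.
have x0 : 0 < x.
  have := posdefmx_diag (lshift p (0 : 'I_1)) P.
  by rewrite block_mxEul mxE eqxx mulr1n ltc0E => /andP[].
split=> //; move: P; rewrite PhiE// => /(posdefmx_congrE _ uL).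
by move=> /posdefmx_block1.
Qed.

Lemma absdet_block1 p (Y : 'M[C]_p) :
  absdet (block_mx 1%:M 0 0 Y : 'M[C]_(1 + p)) = absdet Y.
Proof. by rewrite /absdet det_lblock det1 mul1r. Qed.

Lemma absdet_lowerblock p (r : R) (w : 'cV[C]_p) (L : 'M[C]_p) : 0 < r ->
  absdet (lowerblock r w L) = r * absdet L.
Proof.
move=> r0; rewrite /absdet det_lblock det_scalar1 Normc.normcM normc_real.
by rewrite gtr0_norm.
Qed.

Lemma absdet1 p : absdet (1%:M : 'M[C]_p) = 1.
Proof. by rewrite /absdet det1 Normc.normc1. Qed.

Lemma absdet_Phi p (x : R) (v : 'rV[C]_p) (Y : 'M[C]_p) : 0 < x ->
  absdet (Phi x v Y) = x * absdet Y.
Proof.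
move=> x0; rewrite PhiE// !absdetM absdet_block1 absdet_adj.
rewrite absdet_lowerblock ?rpos_gt0// absdet1 mulr1 mulrAC -expr2.
by rewrite sqr_rpos.
Qed.

(** No term mixes x, v and Y, so exp(-tr) splits into an exponential in x, a Gaussian in v and an
    exponential in Y. *)
Lemma trace_Phi p (x : R) v (Y : 'M[C]_p) :
  Re (\tr (Phi x (rowv v) Y)) =
  x + (\sum_i tnth v.1 i ^+ 2 + \sum_i tnth v.2 i ^+ 2) + Re (\tr Y).
Proof.
rewrite /Phi mxtrace_block mxtrace_scalar mulr1n raddfD raddfD/=.
rewrite raddfD/= -addrA; congr (_ + _); rewrite addrC; congr (_ + _).
rewrite -big_split/= raddf_sum/=; apply: eq_bigr => i _.
rewrite mxE big_ord1 adjmxE !mxE cReM.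
by rewrite -[Num.conj _]/(conjc _)/= mulNr opprK !expr2.
Qed.

Definition vscale p (r : R) (v : p.-tuple RR * p.-tuple RR) :=
  (taff r (nseq_tuple p 0) v.1, taff r (nseq_tuple p 0) v.2).

Lemma rowv_vscale p r (v : p.-tuple RR * p.-tuple RR) :
  rowv (vscale r v) = r%:C *: rowv v.
Proof.
apply/rowP => j; rewrite !mxE !tnth_mktuple !tnth_nseq !addr0.
by apply/eqP; rewrite eq_complex cReM cImM /= !mul0r subr0 addr0 !eqxx.
Qed.

Lemma cov_vscale p (r : R) : 0 < r ->
  cov (cleb p) (cleb p) (vscale r) (cst (r ^+ (p + p))).
Proof.
move=> r0; have H := cov_taff (nseq_tuple p 0) r0.
by apply: cov_ext (cov_prod H H) => // v; rewrite /= exprD.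
Qed.

Definition hPhi p (z : RR * ((p.-tuple RR * p.-tuple RR) * p.-tuple (p.-tuple RR)))
    : hermcoord R p.+1 :=
  hglue (z.1, (vscale (rpos z.1) z.2.1,
    haff (hcoord (adjmx (rowv z.2.1) *m rowv z.2.1)) z.2.2)).

Lemma herm_adjM p q (v : 'M[C]_(q, p)) : adjmx (adjmx v *m v) = adjmx v *m v.
Proof. by rewrite adjmxM adjmxK. Qed.

Lemma hermmx_of_hPhi p z : hermmx_of (@hPhi p z) =
  Phi z.1 (rowv z.2.1) (hermmx_of z.2.2).
Proof.
rewrite hermmx_of_hglue /= hermmx_of_haff rowv_vscale hcoordK//.
exact: herm_adjM.
Qed.

Lemma mxmeas_rowv d (T : measurableType d) p (v : T -> p.-tuple RR * p.-tuple RR) :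
  measurable_fun setT v -> mxmeas (fun t => rowv (v t)).
Proof.
move=> mv i j; under eq_fun do rewrite mxE.
split=> /=.
  apply: (measurableT_comp (measurable_tnth j)).
  exact: (measurableT_comp measurable_fst).
apply: (measurableT_comp (measurable_tnth j)).
exact: (measurableT_comp measurable_snd).
Qed.

Lemma measurable_taff d (T : measurableType d) p (r : T -> R)
    (b t : T -> p.-tuple RR) :
  measurable_fun setT (r : T -> RR) -> measurable_fun setT b ->
  measurable_fun setT t -> measurable_fun setT (fun z => taff (r z) (b z) (t z)).
Proof.
move=> mr mb mt; apply/measurable_fun_tnthP => i.
rewrite (_ : _ \o _ = fun z => (r z * tnth (t z) i + tnth (b z) i : RR)); last first.
  by apply/funext => z /=; rewrite tnth_mktuple.
apply: measurable_funD; last exact: (measurableT_comp (measurable_tnth i)).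
by apply: measurable_funM => //; exact: (measurableT_comp (measurable_tnth i)).
Qed.

Lemma measurable_haff d (T : measurableType d) p (b t : T -> hermcoord R p) :
  measurable_fun setT b -> measurable_fun setT t ->
  measurable_fun setT (fun z => haff (b z) (t z)).
Proof.
move=> mb mt; apply/measurable_fun_tnthP => i.
rewrite (_ : _ \o _ = fun z => taff 1 (tnth (b z) i) (tnth (t z) i)); last first.
  by apply/funext => z /=; rewrite tnth_mktuple.
by apply: measurable_taff => //; exact: (measurableT_comp (measurable_tnth i)).
Qed.

(** For fixed x the border is scaled by sqrt x in 2p real coordinates, which gives the weight x^p
    for x > 0; for fixed v the lower block is translated, with weight 1. *)
Lemma cov_hPhi p :
  cov (hleb p.+1) (sprod leb (sprod (cleb p) (hleb p))) (@hPhi p)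
    (fun z => rpos z.1 ^+ (p + p)).
Proof.
have A : cov (sprod leb (sprod (cleb p) (hleb p)))
    (sprod leb (sprod (cleb p) (hleb p)))
    (fun z => (z.1, (vscale (rpos z.1) z.2.1, z.2.2)))
    (fun z => rpos z.1 ^+ (p + p)).
  have mr : measurable_fun setT
      (fun z : RR * ((p.-tuple RR * p.-tuple RR) * hermcoord R p) => rpos z.1 : RR).
    exact: (measurableT_comp measurable_rpos).
  have m21 : measurable_fun setT
      (fun z : RR * ((p.-tuple RR * p.-tuple RR) * hermcoord R p) => z.2.1).
    exact: (measurableT_comp measurable_fst measurable_snd).
  apply: cov_fiber.
  - apply/measurable_fun_pair; last exact: (measurableT_comp measurable_snd).
    apply/measurable_fun_pair; apply: measurable_taff => //.
      exact: (measurableT_comp measurable_fst m21).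
    exact: (measurableT_comp measurable_snd m21).
  - exact: measurable_funX.
  - move=> x; have := cov_prod (cov_vscale p (rpos_gt0 x)) (cov_id (hleb p)).
    by apply: cov_ext => // z; rewrite mulr1.
have B : cov (sprod (cleb p) (hleb p)) (sprod (cleb p) (hleb p))
    (fun z => (z.1, haff (hcoord (adjmx (rowv z.1) *m rowv z.1)) z.2)) (cst 1).
  apply: cov_fiber => //.
  - apply: measurable_haff => //; apply: measurable_hcoord.
    by apply: mxmeasM; [apply: mxmeas_adj|]; exact: mxmeas_rowv.
  - by move=> v; apply: cov_ext (cov_haff (hcoord (adjmx (rowv v) *m rowv v))) => //.
have := cov_comp (cov_hglue p) (cov_comp A (cov_prod (cov_id leb) B)).
by apply: cov_ext => // z; rewrite /= !mulr1 mul1r.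
Qed.

(** Coordinates of the Schur complement of the corner; [expR (- ln x / 2)] is x^(-1/2) for x > 0 and
    is measurable in x without a case distinction. *)
Definition hschur p (c : hermcoord R p.+1) : hermcoord R p :=
  let X : 'M[C]_(1 + p) := hermmx_of c in
  let v := (expR (- ln (Re (X 0 0)) / 2))%:C *: ursubmx X in
  hcoord (drsubmx X - adjmx v *m v).

(** Solves [Phi] for v and Y: divide the border row by sqrt x, then subtract [adjmx v *m v] from the
    lower block. *)
Lemma hPhi_surj p (c : hermcoord R p.+1) :
  let x := Re ((hermmx_of c : 'M[C]_p.+1) 0 0) in 0 < x ->
  exists v, hermmx_of c = Phi x (rowv v) (hermmx_of (hschur c)).
Proof.
move=> x x0; pose X : 'M[C]_(1 + p) := hermmx_of c.
pose u := (expR (- ln x / 2))%:C *: ursubmx X.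
exists ([tuple (Re (u 0 i) : RR) | i < p], [tuple (Im (u 0 i) : RR) | i < p]).
have -> : rowv ([tuple (Re (u 0 i) : RR) | i < p], [tuple (Im (u 0 i) : RR) | i < p]) = u.
  by apply/rowP => i; rewrite mxE /= !tnth_mktuple; case: (u 0 i).
have hX : adjmx X = X by exact: hermmx_of_herm.
have := hX; rewrite -[in LHS](submxK X) -[in RHS](submxK X).
rewrite /adjmx tr_block_mx map_block_mx => /eq_block_mx[hul hdl hur hdr].
have ru : (rpos x)%:C *: u = ursubmx X.
  rewrite scalerA -rmorphM -expRD -mulrDl addrN mul0r expR0.
  by rewrite scale1r.
rewrite /Phi ru; apply: etrans (esym (submxK X)) _; congr block_mx.
- rewrite [LHS]mx11_scalar; congr (_%:M); rewrite [LHS]mxE [LHS]mxE.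
  have -> : lshift p (0 : 'I_1) = 0 :> 'I_(1 + p) by apply: val_inj.
  by rewrite /x /X mxE; cbv beta zeta; rewrite eqxx.
- by [].
- rewrite /hschur hcoordK; first by rewrite subrK.
  by rewrite adjmxD adjmxN herm_adjM [adjmx _]hdr.
Qed.

Lemma measurable_hschur p : measurable_fun setT (@hschur p).
Proof.
have mX : mxmeas (fun c : hermcoord R p.+1 => hermmx_of c : 'M[C]_(1 + p)).
  by apply: mxmeas_hermmx_of.
have mu : mxmeas (fun c : hermcoord R p.+1 =>
   (expR (- ln (Re ((hermmx_of c : 'M[C]_(1 + p)) 0 0)) / 2))%:C *:
     ursubmx (hermmx_of c : 'M[C]_(1 + p))).
  move=> i j; under eq_fun do rewrite mxE.
  apply: cmeasM; last by under eq_fun do rewrite 2!mxE; exact: mX.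
  apply: cmeas_real; apply: measurableT_comp => //.
  apply: measurable_funM => //; apply: measurableT_comp => //.
  apply: measurableT_comp; first exact: measurable_ln.
  exact: (mX 0 0).1.
apply: measurable_hcoord; apply: mxmeasB.
  by move=> i j; under eq_fun do rewrite 2!mxE; exact: mX.
by apply: mxmeasM => //; exact: mxmeas_adj.
Qed.

(** Positivity is quantified over all vectors, so measurability goes through the Schur recursion:
    the corner is positive and the Schur complement is positive definite. *)
Lemma measurable_posdef p :
  measurable [set c : hermcoord R p | posdefmx (hermmx_of c)].
Proof.
elim: p => [|p ih].
  rewrite (_ : [set _ | _] = setT) //; apply/seteqP; split => // c _ /=.
  split; first by apply/hermsymmxP/matrixP => -[].
  by move=> v; rewrite (thinmx0 v) eqxx.
pose x (c : hermcoord R p.+1) : R := Re ((hermmx_of c : 'M[C]_p.+1) 0 0).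
have mx : measurable_fun setT x.
  exact: (@mxmeas_hermmx_of _ _ _ _ id (@measurable_id _ _ _) 0 0).1.
rewrite (_ : [set _ | _] = [set c | 0 < x c] `&`
    @hschur p @^-1` [set c : hermcoord R p | posdefmx (hermmx_of c)]); last first.
  apply/seteqP; split => c /=.
    move=> P; have x0 : 0 < x c by have := posdefmx_diag 0 P; rewrite ltc0E => /andP[].
    split => //; have [v E] := hPhi_surj x0.
    by move: P; rewrite E => /posdefmx_Phi[].
  move=> [x0 P]; have [v E] := hPhi_surj x0.
  by rewrite E; apply/posdefmx_Phi.
apply: measurableI; last first.
  by rewrite -[X in measurable X]setTI; exact: measurable_hschur.
rewrite -[X in measurable X]setTI.
have := measurable_fun_ltr (@measurable_cst _ _ _ _ setT (0 : R)) mx.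
by move=> /(_ measurableT [set true]); apply.
Qed.

End schur_coordinates.

(** * The matrix-variate gamma integral *)

Section matrix_gamma.
Context {R : realType}.
Local Notation C := R[i].
Local Notation leb := (@lebesgue_measure R).
Local Notation RR := (measurableTypeR R).
Local Open Scope complex_scope.
Local Notation Re := complex.Re.
Local Notation Im := complex.Im.
Local Notation normc := Normc.normc.

Definition mgammaf p (a : C) (X : 'M[C]_p) : C :=
  if `[< posdefmx X >] then
    rpowC (absdet X) (a - p%:R) * (expR (- Re (\tr X)))%:C
  else 0.

Lemma measurable_posdef_comp d (T : measurableType d) p (f : T -> hermcoord R p) :
  measurable_fun setT f -> measurable [set t | posdefmx (hermmx_of (f t))].
Proof.
by move=> mf; have := mf measurableT _ (@measurable_posdef R p); rewrite setTI.
Qed.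

Lemma cmeas_mgammaf d (T : measurableType d) p a (f : T -> hermcoord R p) :
  measurable_fun setT f -> cmeas (fun t => mgammaf a (hermmx_of (f t))).
Proof.
move=> mf; have mX := mxmeas_hermmx_of mf.
apply: (cmeas_if (measurable_posdef_comp mf)).
apply: cmeasM.
  exact/cmeas_rpowC/measurable_absdet.
apply: cmeas_real; apply: measurableT_comp => //; apply: measurableT_comp => //.
have : cmeas (fun t => \tr (hermmx_of (f t))).
  by apply: cmeas_sum => i; exact: mX.
by case.
Qed.

Lemma cintegrable_gauss : cintegrable leb setT (fun t : RR => (gauss_fun t)%:C).
Proof.
split; first exact: integrableT_gauss.
by apply: integrable0.
Qed.

Lemma cintegral_gauss :
  cintegral leb setT (fun t : RR => (gauss_fun t)%:C) = (Num.sqrt pi)%:C.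
Proof.
rewrite /cintegral /Rintegral/= integralT_gauss/=.
by apply/eqP; rewrite eq_complex/= integral0 !eqxx.
Qed.

Lemma cintegral_gauss_tuple p :
  cintegrable (tuple_measure leb p) setT
    (fun t => \prod_i (gauss_fun (tnth t i : R))%:C) /\
  cintegral (tuple_measure leb p) setT
    (fun t => \prod_i (gauss_fun (tnth t i : R))%:C) = (Num.sqrt pi ^+ p)%:C.
Proof.
have [I E] := @cintegral_tupleM _ _ _ leb p (fun _ t => (gauss_fun t)%:C)
  (fun=> cintegrable_gauss).
split => //; apply: etrans E _.
under eq_bigr do rewrite cintegral_gauss.
by rewrite prodr_const card_ord rmorphXn.
Qed.

Definition gaussv p (v : p.-tuple RR * p.-tuple RR) : C :=
  (\prod_i (gauss_fun (tnth v.1 i : R))%:C) *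
  (\prod_i (gauss_fun (tnth v.2 i : R))%:C).

Lemma gaussvE p (v : p.-tuple RR * p.-tuple RR) :
  gaussv v = (expR (- (\sum_i (tnth v.1 i : R) ^+ 2 +
    \sum_i (tnth v.2 i : R) ^+ 2)))%:C.
Proof.
rewrite /gaussv -!rmorph_prod -rmorphM; congr (_%:C).
by rewrite opprD expRD -!sumrN !expR_sum.
Qed.

Lemma cintegral_gaussv p :
  cintegrable (cleb p) setT (@gaussv p) /\
  cintegral (cleb p) setT (@gaussv p) = (pi ^+ p)%:C.
Proof.
have [I E] := cintegral_gauss_tuple p.
have [I' E'] := cintegral_sprodM I I; split => //; apply: etrans E' _.
by rewrite !E -rmorphM -exprMn -expr2 sqr_sqrtr ?pi_ge0.
Qed.

(** In size p + 1 the determinant contributes x^(a-p-1) |det Y|^(a-p-1). The weight x^p turns the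
    first factor into x^(a-1), and the second has exponent (a - 1) - p: the parameter drops by 1
    with the size. *)
Lemma mgammaf_hPhi p a z :
  mgammaf a (hermmx_of (@hPhi R p z)) * (rpos z.1 ^+ (p + p))%:C =
  gammaf a z.1 * (gaussv z.2.1 * mgammaf (a - 1) (hermmx_of z.2.2)).
Proof.
rewrite hermmx_of_hPhi; case: z => x [v c] /=; set Y := hermmx_of c.
rewrite /mgammaf /gammaf; case: ifPn => [/asboolP/posdefmx_Phi[x0 Y0]|P].
  rewrite x0 (asboolT Y0) absdet_Phi// trace_Phi gaussvE.
  rewrite rpowCM//; last exact/absdet_gt0/posdefmx_det.
  rewrite addnn -mul2n exprM sqr_rpos// -rpowC_nat//.
  rewrite -addrA !opprD !expRD !rmorphM/=.
  have -> : rpowC x (a - 1) = rpowC x (a - p.+1%:R) * rpowC x p%:R.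
    by rewrite -rpowCD -natr1 opprD addrA addrAC subrK.
  have -> : a - 1 - p%:R = a - p.+1%:R by rewrite -natr1 opprD addrA addrAC.
  by ring.
rewrite mul0r; case: ifPn => x0; last by rewrite mul0r.
case: ifPn => [/asboolP Y0|_]; last by rewrite !mulr0.
by move/asboolP: P; case; apply/posdefmx_Phi.
Qed.

Lemma mxgammaS p a : @mxgamma R p.+1 a =
  gammaC a * ((pi ^+ p)%:C * mxgamma p (a - 1)).
Proof.
rewrite /mxgamma big_ord_recl subr0 mulrCA; congr (_ * _).
rewrite mulrA -rmorphM -exprD; congr (_ * _).
  (* Powers of pi: (p+1)p/2 = p + p(p-1)/2, the summand p being that of the Gaussian integral over
     the border. *)
  congr (_%:C); congr (_ ^+ _); rewrite -[X in X./2]/(p.+1 * p)%N.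
  have -> : (p.+1 * p = p.*2 + p * p.-1)%N.
    by case: p => // q; rewrite -muln2 -mulnDr add2n mulnC.
  by rewrite halfD odd_double doubleK.
by apply: eq_bigr => i _; rewrite -[X in a - 1 - X]/(i%:R) lift0 -natr1 opprD addrA addrAC.
Qed.

Lemma mgammaf_integral p a : p%:R - 1 < Re a ->
  cintegrable (hleb p) setT (fun c => mgammaf a (hermmx_of c)) /\
  cintegral (hleb p) setT (fun c => mgammaf a (hermmx_of c)) = mxgamma p a.
Proof.
elim: p a => [|p ih] a pa.
  have E : (fun c : hermcoord R 0 => mgammaf a (hermmx_of c)) = cst 1.
    apply/funext => c; rewrite /mgammaf asboolT; last first.
      split; first by apply/hermsymmxP/matrixP => -[].
      by move=> v; rewrite (thinmx0 v) eqxx.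
    rewrite /absdet det_mx00 Normc.normc1 rpow1C mul1r /mxtrace big_ord0.
    by rewrite oppr0 expR0.
  (* The empty product, for any family, shows that the constant 1 has integral 1 over 0-tuples. *)
  have [|I0 E0] := @cintegral_tupleM _ _ _ (tuple_measure leb 0) 0 (fun _ _ => 0).
    by move=> i; have := ltn_ord i; rewrite ltn0.
  move: I0 E0; rewrite (_ : (fun _ => _) = cst 1); last first.
    by apply/funext => t; rewrite big_ord0.
  by rewrite E big_ord0 /mxgamma big_ord0 mulr1 expr0.
have a0 : 0 < Re a.
  by apply: le_lt_trans pa; rewrite -natr1 addrK.
have pa1 : p%:R - 1 < Re (a - 1).
  by rewrite raddfB/= ltrD2r -(ltrD2r (-1)) in pa *; move: pa; rewrite -natr1 addrK; lra.
have [I E] := ih _ pa1.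
have mf := cmeas_mgammaf a (@measurable_id _ (hermcoord R p.+1) setT).
have [Ig Eg] := cintegral_gaussv p.
have [I2 E2] := cintegral_sprodM Ig I.
have [I3 E3] := cintegral_sprodM (cintegrable_gammaf a0) I2.
have X : (fun z => mgammaf a (hermmx_of (@hPhi R p z)) * (rpos z.1 ^+ (p + p))%:C) =
  (fun z => gammaf a z.1 * (gaussv z.2.1 * mgammaf (a - 1) (hermmx_of z.2.2))).
  by apply/funext => z; exact: mgammaf_hPhi.
split.
  by apply/(cov_cintegrable (cov_hPhi p) mf); rewrite X.
by rewrite (cov_cintegral (cov_hPhi p) mf) X E3 E2 E Eg -gammaCE mxgammaS.
Qed.

End matrix_gamma.

(** * The Jacobian of a congruence *)

Section congruence_jacobian.
Context {R : realType}.
Local Notation C := R[i].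
Local Notation leb := (@lebesgue_measure R).
Local Notation RR := (measurableTypeR R).
Local Notation cvec p := (p.-tuple RR * p.-tuple RR)%type.
Local Open Scope complex_scope.
Local Notation Re := complex.Re.
Local Notation Im := complex.Im.

(** Transfers a change of variables through the measure-preserving chart [h]: [psi] acts on [T] as
    [phi] acts on the coordinates. *)
Lemma cov_transport d1 d2 (T : measurableType d1) (U : measurableType d2)
    (mu : {measure set T -> \bar R}) (nu : {measure set U -> \bar R})
    (h : U -> T) (phi : U -> U) (psi : T -> T) (k : R) :
  cov mu nu h (cst 1) -> cov nu nu phi (cst k) -> measurable_fun setT psi ->
  (forall u, psi (h u) = h (phi u)) -> cov mu mu psi (cst k).
Proof.
move=> [mh _ _ H] [mphi _ k0 K] mpsi E; split => //.
  by move=> x; have := k0 point.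
move=> f mf f0; have mfh : measurable_fun setT (fun u => f (h u) * (cst 1 u)%:E)%E.
  by apply: emeasurable_funM => //; exact: measurableT_comp.
rewrite H// K//; last by move=> u; rewrite mule1.
rewrite H.
- by apply: eq_integral => u _; rewrite !mule1 E.
- by apply: emeasurable_funM => //; exact: measurableT_comp.
- by move=> x; rewrite mule_ge0// lee_fin; exact: (k0 point).
Qed.

Definition vcoord p (u : 'rV[C]_p) : cvec p :=
  ([tuple (Re (u 0 i) : RR) | i < p], [tuple (Im (u 0 i) : RR) | i < p]).

Lemma vcoordK p : cancel (@vcoord p) (@rowv R p).
Proof.
by move=> u; apply/rowP => i; rewrite mxE /= !tnth_mktuple; case: (u 0 i).
Qed.

Lemma rowv_inj p : injective (@rowv R p).
Proof.
move=> [a b] [a' b'] /rowP E; congr pair; apply: eq_from_tnth => i;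
  by have := E i; rewrite !mxE => -[].
Qed.

Lemma hermmx_of_inj p : injective (@hermmx_of R p).
Proof.
move=> c c' /matrixP E; apply: eq_from_tnth => i; apply: eq_from_tnth => j.
have [ij|ji|/val_inj ij] := ltngtP i j.
- have := E i j; rewrite !mxE; cbv beta zeta; rewrite ij.
  by rewrite (_ : (i == j) = false) => [[]|]//; apply/eqP => e; rewrite e ltnn in ij.
- have := E j i; rewrite !mxE; cbv beta zeta; rewrite ji.
  by rewrite (_ : (j == i) = false) => [[]|]//; apply/eqP => e; rewrite e ltnn in ji.
- by have := E i j; rewrite !mxE; cbv beta zeta; rewrite ij eqxx => -[].
Qed.

Lemma measurable_vcoord d (T : measurableType d) p (u : T -> 'rV[C]_p) :
  mxmeas u -> measurable_fun setT (fun t => vcoord (u t)).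
Proof.
move=> mu; apply/measurable_fun_pair; apply/measurable_fun_tnthP => i.
  rewrite (_ : _ \o _ = fun t => Re (u t 0 i) : RR); first exact: (mu 0 i).1.
  by apply/funext => t /=; rewrite tnth_mktuple.
rewrite (_ : _ \o _ = fun t => Im (u t 0 i) : RR); first exact: (mu 0 i).2.
by apply/funext => t /=; rewrite tnth_mktuple.
Qed.

Definition vaff p (r : R) (b v : cvec p) : cvec p := (taff r b.1 v.1, taff r b.2 v.2).

Lemma rowv_vaff p r (b v : cvec p) : rowv (vaff r b v) = r%:C *: rowv v + rowv b.
Proof.
apply/rowP => j; rewrite !mxE !tnth_mktuple.
by apply/eqP; rewrite eq_complex !raddfD /= !mul0r subr0 addr0 !eqxx.
Qed.

Lemma cov_vaff p r (b : cvec p) : 0 < r ->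
  cov (cleb p) (cleb p) (vaff r b) (cst (r ^+ (p + p))).
Proof.
move=> r0; apply: cov_ext (cov_prod (cov_taff b.1 r0) (cov_taff b.2 r0)) => // v.
by rewrite /= exprD.
Qed.

Definition vglue p (z : (RR * RR) * cvec p) : cvec p.+1 :=
  (cons_pair (z.1.1, z.2.1), cons_pair (z.1.2, z.2.2)).

Lemma cov_vglue p :
  cov (cleb p.+1) (sprod (sprod leb leb) (cleb p)) (@vglue p) (cst 1).
Proof.
have := cov_comp (cov_prod (cov_cons leb p) (cov_cons leb p))
  (cov_interchange leb (tuple_measure leb p) leb (tuple_measure leb p)).
by apply: cov_ext => // z; rewrite /= !mulr1.
Qed.

Lemma rowv_vglue p (z : (RR * RR) * cvec p) :
  rowv (vglue z) =
  row_mx (((z.1.1 : R) +i* (z.1.2 : R))%:M) (rowv z.2) :> 'rV[C]_(1 + p).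
Proof.
have l0 : ord0 = lshift p (0 : 'I_1) by apply: val_inj.
have lS (i : 'I_p) : lift ord0 i = rshift 1 i by apply: val_inj.
apply/rowP => j; have [j' ->|->] := unliftP ord0 j.
  by rewrite [in RHS]lS row_mxEr !mxE /= !tnthS.
by rewrite [in RHS]l0 row_mxEl !mxE /= !tnth0.
Qed.

(** The part of a block congruence that acts on the border row. *)
Definition vmul p (L : 'M[C]_p) (v : cvec p) : cvec p :=
  vcoord (rowv v *m adjmx L).

Definition hcongr p (L : 'M[C]_p) (c : hermcoord R p) : hermcoord R p :=
  hcoord (L *m hermmx_of c *m adjmx L).

Lemma hermmx_of_hcongr p L (c : hermcoord R p) :
  hermmx_of (hcongr L c) = L *m hermmx_of c *m adjmx L.
Proof.
by rewrite hcoordK// !adjmxM adjmxK hermmx_of_herm mulmxA.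
Qed.

Lemma measurable_vmul p (L : 'M[C]_p) : measurable_fun setT (vmul L).
Proof.
apply: measurable_vcoord; apply: mxmeasM; last exact: mxmeas_cst.
exact: (mxmeas_rowv (@measurable_id _ _ setT)).
Qed.

Lemma measurable_hcongr p (L : 'M[C]_p) : measurable_fun setT (hcongr L).
Proof.
apply: measurable_hcoord; apply: mxmeasM; last exact: mxmeas_cst.
apply: mxmeasM; first exact: mxmeas_cst.
exact: (mxmeas_hermmx_of (@measurable_id _ _ setT)).
Qed.

Lemma vmul_lowerblock p r w (L : 'M[C]_p) z :
  vmul (lowerblock r w L) (vglue z) =
  vglue ((r * (z.1.1 : R) : RR, r * (z.1.2 : R) : RR),
    vaff 1 (vcoord (((z.1.1 : R) +i* (z.1.2 : R)) *: adjmx w)) (vmul L z.2)).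
Proof.
apply: rowv_inj; rewrite vcoordK !rowv_vglue adj_lowerblock mul_row_block.
rewrite rowv_vaff !vcoordK mulmx0 addr0 scale1r mul_scalar_mx scale_scalar_mx.
rewrite mul_scalar_mx [X in row_mx _ X]addrC; congr row_mx; congr (_%:M).
by apply/eqP; rewrite eq_complex cReM cImM /= !mulr0 subr0 add0r ![r * _]mulrC !eqxx.
Qed.

(** The first entry is multiplied by r, with weight r^2, and the others undergo [vmul L] followed by
    a translation depending on the first entry. The squares are those of a complex linear map seen
    over the reals, of Jacobian |det|^2. *)
Lemma cov_vmul_lowerblock p r w (L : 'M[C]_p) : 0 < r ->
  cov (cleb p) (cleb p) (vmul L) (cst (absdet L ^+ 2)) ->
  cov (cleb p.+1) (cleb p.+1) (vmul (lowerblock r w L))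
    (cst (absdet (lowerblock r w L) ^+ 2)).
Proof.
move=> r0 H; rewrite absdet_lowerblock//.
have A : cov (sprod (sprod leb leb) (cleb p)) (sprod (sprod leb leb) (cleb p))
   (fun z => (z.1, vaff 1 (vcoord (((z.1.1 : R) +i* (z.1.2 : R)) *: adjmx w))
      (vmul L z.2))) (cst (absdet L ^+ 2)).
  apply: cov_fiber => //.
    have : measurable_fun setT (fun z : (RR * RR) * cvec p =>
       vcoord (1%:C *: (rowv z.2 *m adjmx L) +
         ((z.1.1 : R) +i* (z.1.2 : R)) *: adjmx w)).
      have m1 : cmeas (fun z : (RR * RR) * cvec p => (z.1.1 : R) +i* (z.1.2 : R)).
        split => /=; first exact: (measurableT_comp measurable_fst measurable_fst).
        exact: (measurableT_comp measurable_snd measurable_fst).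
      apply: measurable_vcoord; apply: mxmeasD.
        move=> i j; under eq_fun do rewrite mxE.
        apply: cmeasM; first exact: cmeas_cst.
        move: i j; apply: mxmeasM; last exact: mxmeas_cst.
        exact: (mxmeas_rowv (@measurable_snd _ _ _ _)).
      move=> i j; under eq_fun do rewrite mxE.
      by apply: cmeasM => //; exact: cmeas_cst.
    congr measurable_fun; apply/funext => z; apply: rowv_inj.
    by rewrite vcoordK rowv_vaff !vcoordK.
  move=> v0.
  pose b : cvec p := vcoord (((v0.1 : R) +i* (v0.2 : R)) *: adjmx w).
  apply: cov_ext (cov_comp (cov_vaff b ltr01) H) => // v.
  by rewrite /= expr1n mul1r.
have B : cov (sprod (sprod leb leb) (cleb p)) (sprod (sprod leb leb) (cleb p))
    (fun z => ((r * (z.1.1 : R) + 0 : RR, r * (z.1.2 : R) + 0 : RR), z.2))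
    (cst (r ^+ 2)).
  apply: cov_ext (cov_prod (cov_prod (cov_affine 0 r0) (cov_affine 0 r0))
    (cov_id (cleb p))) => // z.
  by rewrite /= mulr1.
have := cov_transport (cov_vglue p) _ (measurable_vmul (lowerblock r w L)) (fun z => vmul_lowerblock r w L z).
apply; apply: cov_ext (cov_comp B A) => z; first by rewrite /= !addr0.
by rewrite /= exprMn.
Qed.

(** Block triangularity of the congruence: the new corner depends on the corner alone, the new
    border on corner and border, and the block undergoes [hcongr L] up to a translation fixed by the
    other two. *)
Lemma hcongr_lowerblock p r w (L : 'M[C]_p) z :
  hcongr (lowerblock r w L) (hglue z) =
  hglue (r ^+ 2 * (z.1 : R) : RR,
    (vaff r (vcoord ((r * (z.1 : R))%:C *: adjmx w)) (vmul L z.2.1),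
     haff (hcoord ((z.1 : R)%:C *: (w *m adjmx w) +
        (w *m (rowv z.2.1 *m adjmx L) + adjmx (rowv z.2.1 *m adjmx L) *m adjmx w)))
       (hcongr L z.2.2))).
Proof.
case: z => x [v c]; rewrite /=.
apply: hermmx_of_inj; rewrite hermmx_of_hcongr !hermmx_of_hglue /=.
rewrite hermmx_of_haff rowv_vaff !vcoordK hermmx_of_hcongr adj_lowerblock.
pose q := rowv v *m adjmx L; rewrite -/q.
have aq : L *m adjmx (rowv v) = adjmx q by rewrite adjmxM adjmxK.
rewrite hcoordK; last first.
  rewrite !adjmxD adjmxZ_real !adjmxM !adjmxK; congr (_ + _).
  by rewrite addrC.
rewrite /lowerblock !mulmx_block !(mul0mx, mulmx0, addr0, add0r).
congr block_mx.
- by rewrite -!scalar_mxM -!rmorphM /=; congr (_%:C%:M); rewrite expr2 mulrAC.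
- by rewrite -scalar_mxM -mulmxA -/q !mul_scalar_mx -rmorphM addrC.
- rewrite aq mul_mx_scalar mul_mx_scalar scalerDr scalerA -rmorphM addrC.
  by rewrite adjmxD !adjmxZ_real adjmxK.
- rewrite aq mulmxDl mulmxDl mul_mx_scalar -scalemxAl -[w *m rowv v *m _]mulmxA -/q.
  by rewrite addrACA [RHS]addrC !addrA.
Qed.

End congruence_jacobian.

(** * Cholesky factors and the weights of their congruences *)

Section cholesky.
Context {R : realType}.
Local Notation C := R[i].
Local Notation leb := (@lebesgue_measure R).
Local Notation RR := (measurableTypeR R).
Local Notation cvec p := (p.-tuple RR * p.-tuple RR)%type.
Local Open Scope complex_scope.
Local Notation Re := complex.Re.
Local Notation Im := complex.Im.

(** The weights are r^2 for the corner, r^(2p) |det L|^2 for the border and |det L|^(2p) for the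
    block; their product is (r |det L|)^(2(p+1)). *)
Lemma cov_hcongr_lowerblock p (r : R) w (L : 'M[C]_p) : 0 < r ->
  cov (cleb p) (cleb p) (vmul L) (cst (absdet L ^+ 2)) ->
  cov (hleb p) (hleb p) (hcongr L) (cst (absdet L ^+ (p + p))) ->
  cov (hleb p.+1) (hleb p.+1) (hcongr (lowerblock r w L))
    (cst (absdet (lowerblock r w L) ^+ (p.+1 + p.+1))).
Proof.
move=> r0 Hv Hh; rewrite absdet_lowerblock//.
set M := sprod leb (sprod (cleb p) (hleb p)).
pose B (x : RR) (v : cvec p) : hermcoord R p :=
  hcoord ((x : R)%:C *: (w *m adjmx w) +
    (w *m (rowv v *m adjmx L) + adjmx (rowv v *m adjmx L) *m adjmx w)).
pose b (x : RR) : cvec p := vcoord ((r * (x : R))%:C *: adjmx w).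
have mB : measurable_fun setT (fun z : RR * (cvec p * hermcoord R p) => B z.1 z.2.1).
  have mv : mxmeas (fun z : RR * (cvec p * hermcoord R p) =>
      rowv z.2.1 *m adjmx L).
    apply: mxmeasM; last exact: mxmeas_cst.
    exact: (mxmeas_rowv (measurableT_comp measurable_fst measurable_snd)).
  apply: measurable_hcoord; apply: mxmeasD; last apply: mxmeasD.
  - move=> i j; under eq_fun do rewrite mxE.
    by apply: cmeasM; [apply: cmeas_real|exact: cmeas_cst].
  - by apply: mxmeasM => //; exact: mxmeas_cst.
  - by apply: mxmeasM; [exact: mxmeas_adj|exact: mxmeas_cst].
have mb : measurable_fun setT b.
  apply: measurable_vcoord => i j; under eq_fun do rewrite mxE.
  apply: cmeasM; last exact: cmeas_cst.
  by apply: cmeas_real; exact: measurable_funM.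
have mpair2 (x : RR) : measurable_fun setT
    (fun y : cvec p * hermcoord R p => (x, y)) by exact: pair1_measurable.
have C1 : cov M M (fun z => (z.1, (z.2.1, haff (B z.1 z.2.1) (hcongr L z.2.2))))
    (cst (absdet L ^+ (p + p))).
  have mh (x : RR) : measurable_fun setT (fun z : cvec p * hermcoord R p =>
      haff (B x z.1) (hcongr L z.2)).
    apply: measurable_haff; first exact: (measurableT_comp mB (mpair2 x)).
    exact: (measurableT_comp (measurable_hcongr L) measurable_snd).
  apply: cov_fiber => //.
    apply/measurable_fun_pair; first exact: (measurableT_comp measurable_fst).
    apply: measurable_haff => //.
    apply: (measurableT_comp (measurable_hcongr L)).
    exact: (measurableT_comp measurable_snd).
  move=> x; apply: (@cov_fiber _ _ _ _ _ _ _ (hleb p) (hleb p) (cleb p)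
    (fun z => haff (B x z.1) (hcongr L z.2))) => //.
  move=> v; apply: cov_ext (cov_comp (cov_haff (B x v)) Hh) => // c.
  by rewrite /= mul1r.
have C2 : cov M M (fun z => (z.1, (vaff r (b z.1) (vmul L z.2.1), z.2.2)))
    (cst (r ^+ (p + p) * absdet L ^+ 2)).
  apply: cov_fiber => //.
    apply/measurable_fun_pair; last exact: (measurableT_comp measurable_snd).
    have mbz : measurable_fun setT (fun z : RR * (cvec p * hermcoord R p) => b z.1).
      exact: (measurableT_comp mb).
    have mvz : measurable_fun setT
        (fun z : RR * (cvec p * hermcoord R p) => vmul L z.2.1).
      apply: (measurableT_comp (measurable_vmul L)).
      exact: (measurableT_comp measurable_fst).
    apply/measurable_fun_pair; apply: measurable_taff => //.
    - exact: (measurableT_comp measurable_fst).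
    - exact: (measurableT_comp measurable_fst).
    - exact: (measurableT_comp measurable_snd).
    - exact: (measurableT_comp measurable_snd).
  move=> x.
  have := cov_prod (cov_comp (cov_vaff (b x) r0) Hv) (cov_id (hleb p)).
  by apply: cov_ext => // z; rewrite /= mulr1.
have C3 : cov M M (fun z => (r ^+ 2 * (z.1 : R) + 0 : RR, z.2)) (cst (r ^+ 2)).
  apply: cov_ext (cov_prod (cov_affine 0 (exprn_gt0 2 r0)) (cov_id _)) => // z.
  by rewrite /= mulr1.
apply: (cov_transport (cov_hglue p) _ (measurable_hcongr _)
  (fun z => hcongr_lowerblock r w L z)).
(* The block is moved first and the corner last, so that each translation is computed from
   coordinates not yet changed. *)
apply: cov_ext (cov_comp C3 (cov_comp C2 C1)) => z; first by rewrite /= addr0.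
by rewrite /= exprMn addSn addnS !exprS expr0 mulr1; ring.
Qed.

Lemma lowerblock_adjM p (x : R) (v : 'rV[C]_p) (L : 'M[C]_p) : 0 < x ->
  lowerblock (rpos x) (adjmx v) L *m adjmx (lowerblock (rpos x) (adjmx v) L) =
  Phi x v (L *m adjmx L).
Proof.
move=> x0; rewrite adj_lowerblock /Phi /lowerblock mulmx_block adjmxK.
rewrite !(mul0mx, mulmx0, addr0, add0r) mul_scalar_mx mul_mx_scalar.
rewrite mul_scalar_mx scale_scalar_mx -rmorphM -expr2 sqr_rpos//.
by rewrite adjmxZ_real addrC.
Qed.

(** Both weights are carried through the Schur recursion together with the factor: the congruence
    weight in size p + 1 uses the two weights in size p. *)
Lemma cholesky_cov p (c : hermcoord R p) : posdefmx (hermmx_of c) ->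
  exists L : 'M[C]_p, [/\ L \in unitmx, hermmx_of c = L *m adjmx L,
    cov (cleb p) (cleb p) (vmul L) (cst (absdet L ^+ 2)) &
    cov (hleb p) (hleb p) (hcongr L) (cst (absdet L ^+ (p + p)))].
Proof.
elim: p c => [|p ih] c P.
  have a1 (A : 'M[C]_0) : absdet A = 1 by rewrite /absdet det_mx00 Normc.normc1.
  exists 1%:M; split; first exact: unitmx1.
  - by apply/matrixP => -[].
  - rewrite a1 expr1n; apply: cov_ext (cov_id _) => // v.
    by apply: rowv_inj; apply/rowP => -[].
  - rewrite a1 expr1n; apply: cov_ext (cov_id _) => // v.
    by apply: hermmx_of_inj; apply/matrixP => -[].
have x0 : 0 < Re ((hermmx_of c : 'M[C]_p.+1) 0 0).
  by have := posdefmx_diag 0 P; rewrite ltc0E => /andP[].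
have [v E] := hPhi_surj x0.
have /posdefmx_Phi[_ P'] : posdefmx (Phi (Re ((hermmx_of c : 'M[C]_p.+1) 0 0)) (rowv v)
  (hermmx_of (hschur c))) by rewrite -E.
have [L [uL eL Hv Hh]] := ih _ P'.
set x := Re _ in x0 E *.
have r0 := rpos_gt0 x.
exists (lowerblock (rpos x) (adjmx (rowv v)) L); split.
- exact: unitmx_lowerblock.
- by rewrite E eL; exact: esym (lowerblock_adjM _ _ x0).
- exact: cov_vmul_lowerblock.
- exact: cov_hcongr_lowerblock.
Qed.

End cholesky.

(** * The Dirichlet integral *)

Section dirichlet_integral.
Context {R : realType}.
Local Notation C := R[i].
Local Open Scope complex_scope.
Local Notation Re := complex.Re.
Local Notation Im := complex.Im.
Local Notation normc := Normc.normc.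

Lemma mxgamma_neq0 p (a : C) : p%:R - 1 < Re a -> mxgamma p a != 0.
Proof.
move=> pa; rewrite /mxgamma mulf_neq0//.
  apply/eqP => /(congr1 (@complex.Re R)) /= /eqP.
  by rewrite gt_eqF// exprn_gt0// pi_gt0.
apply/prodf_neq0 => i _; apply: gammaC_neq0.
rewrite raddfB/= raddfMn/= -[X in 0 < _ - X]/(i%:R).
rewrite subr_gt0; apply: le_lt_trans pa.
by rewrite lerBrDr natr1 ler_nat.
Qed.

(** Links the modulus to the value: |G_s| has a positive integral once [mxgamma p s] is known to be
    nonzero. *)
Lemma cintegral_eq0 d (T : measurableType d) (mu : {measure set T -> \bar R})
    (f : T -> C) : cintegrable mu setT f ->
  (\int[mu]_x (normc (f x))%:E = 0)%E -> cintegral mu setT f = 0.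
Proof.
move=> If f0; have /cintegrableP[mf _] := If; case: If => i1 i2.
have mn : measurable_fun setT (fun x => (normc (f x))%:E).
  by apply/measurable_EFinP; exact: measurable_normc.
have E (g : T -> R) : mu.-integrable setT (EFin \o g) ->
    (forall x, `|g x| <= normc (f x)) -> \int[mu]_x g x = 0.
  move=> ig gf; apply/eqP; rewrite -normr_le0.
  apply: le_trans (le_normr_Rintegral measurableT ig) _.
  rewrite /Rintegral fine_le0// -f0; apply: ge0_le_integral => //.
  - by have /integrableP[mg _] := ig; apply/measurable_EFinP; apply: measurableT_comp => //; apply/measurable_EFinP.
  - by move=> x _; rewrite lee_fin.
by rewrite /cintegral !E// => x; [exact: ler_normIm|exact: ler_normRe].
Qed.

Variables (p k : nat) (a : 'I_k -> C) (b : C).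
Local Notation mk := (tuple_measure (hleb p) k).
Local Notation s := (\sum_j a j + b).
Hypothesis pa : forall j, p%:R - 1 < Re (a j).
Hypothesis pb : p%:R - 1 < Re b.
Hypothesis ps : p%:R - 1 < Re s.

Let mgammaf0 n (c : C) (X : 'M[C]_n) : ~ posdefmx X -> mgammaf c X = 0.
Proof. by move=> nX; rewrite /mgammaf asboolF. Qed.

Let mgammaf_pos n (c : C) (X : 'M[C]_n) : posdefmx X -> mgammaf c X =
  rpowC (absdet X) (c - n%:R) * (expR (- Re (\tr X)))%:C.
Proof. by move=> PX; rewrite /mgammaf asboolT. Qed.

(** Unnormalised Dirichlet density; [a j] will be alpha_j + gamma_j and [b] will be alpha_(k+1). *)
Definition dirichlet_kernel (t : k.-tuple (hermcoord R p)) : C :=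
  if `[< (forall j, posdefmx (hermmx_of (tnth t j))) /\
         posdefmx (1%:M - \sum_j hermmx_of (tnth t j)) >] then
    (\prod_j rpowC (absdet (hermmx_of (tnth t j))) (a j - p%:R)) *
    rpowC (absdet (1%:M - \sum_j hermmx_of (tnth t j))) (b - p%:R)
  else 0.

(** X_(k+1) = S - (X_1 + ... + X_k) in coordinates, with [z.2] standing for S. *)
Definition remainder (z : k.-tuple (hermcoord R p) * hermcoord R p) : hermcoord R p :=
  haff (hcoord (- \sum_j hermmx_of (tnth z.1 j))) z.2.

Lemma adjmx_sum (I : Type) (r : seq I) n (F : I -> 'M[C]_n) :
  adjmx (\sum_(i <- r) F i) = \sum_(i <- r) adjmx (F i).
Proof.
elim: r => [|i r ih]; last by rewrite !big_cons adjmxD ih.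
by rewrite !big_nil /adjmx trmx0 map_mx0.
Qed.

Lemma hermmx_of_remainder z :
  hermmx_of (remainder z) = hermmx_of z.2 - \sum_j hermmx_of (tnth z.1 j).
Proof.
rewrite hermmx_of_haff hcoordK// adjmxN adjmx_sum; congr (- _).
by apply: eq_bigr => j _; rewrite hermmx_of_herm.
Qed.

Lemma mxmeas_tnth d (T : measurableType d) (f : T -> k.-tuple (hermcoord R p)) j :
  measurable_fun setT f -> mxmeas (fun t => hermmx_of (tnth (f t) j)).
Proof.
by move=> mf; apply: mxmeas_hermmx_of; exact: (measurableT_comp (measurable_tnth j)).
Qed.

Lemma measurable_remainder : measurable_fun setT remainder.
Proof.
apply: measurable_haff => //; apply: measurable_hcoord; apply: mxmeasN.
by apply: mxmeas_sum => j; exact: mxmeas_tnth.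
Qed.

Definition gamma_integrand (z : k.-tuple (hermcoord R p) * hermcoord R p) : C :=
  (\prod_j mgammaf (a j) (hermmx_of (tnth z.1 j))) * mgammaf b (hermmx_of z.2).

Definition shifted_integrand (z : k.-tuple (hermcoord R p) * hermcoord R p) : C :=
  gamma_integrand (z.1, remainder z).

Lemma cmeas_gamma_integrand : cmeas gamma_integrand.
Proof.
apply: cmeasM; last exact: cmeas_mgammaf.
apply: cmeas_prod => j; apply: cmeas_mgammaf.
exact: (measurableT_comp (measurable_tnth j)).
Qed.

Lemma gamma_integrand_integral :
  cintegrable (sprod mk (hleb p)) setT gamma_integrand /\
  cintegral (sprod mk (hleb p)) setT gamma_integrand =
    (\prod_j mxgamma p (a j)) * mxgamma p b.
Proof.
have [I E] := @cintegral_tupleM _ _ _ (hleb p) k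
  (fun j c => mgammaf (a j) (hermmx_of c)) (fun j => (mgammaf_integral (pa j)).1).
have [Ib Eb] := mgammaf_integral pb.
have [I2 E2] := cintegral_sprodM I Ib; split => //; apply: etrans E2 _.
rewrite E Eb; congr (_ * _); apply: eq_bigr => j _.
exact: (mgammaf_integral (pa j)).2.
Qed.

Lemma cov_shear : cov (sprod mk (hleb p)) (sprod mk (hleb p))
  (fun z => (z.1, remainder z)) (cst 1).
Proof.
apply: cov_fiber => //; first exact: measurable_remainder.
by move=> t; apply: cov_ext (cov_haff (hcoord (- \sum_j hermmx_of (tnth t j)))) => //.
Qed.

Lemma cmeas_shifted_integrand : cmeas shifted_integrand.
Proof.
apply: (cmeas_comp cmeas_gamma_integrand).
by apply/measurable_fun_pair => //; exact: measurable_remainder.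
Qed.

Lemma shifted_integrand_integral :
  cintegrable (sprod mk (hleb p)) setT shifted_integrand /\
  cintegral (sprod mk (hleb p)) setT shifted_integrand =
    (\prod_j mxgamma p (a j)) * mxgamma p b.
Proof.
have [I <-] := gamma_integrand_integral.
have X : (fun z => gamma_integrand (z.1, remainder z) * (cst 1 z)%:C) = shifted_integrand.
  by apply/funext => z; rewrite mulr1.
have m := cmeas_gamma_integrand.
split; last by rewrite (cov_cintegral cov_shear m) X.
by move: I => /(cov_cintegrable cov_shear m); rewrite X.
Qed.

(** S is the sum of the X_j and of the remainder; where the integrand does not vanish, all of these
    are positive definite. *)
Lemma shifted_integrand_notpos S t : ~ posdefmx (hermmx_of S) ->
  shifted_integrand (t, S) = 0.
Proof.
move=> nS; rewrite /shifted_integrand /gamma_integrand /=.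
have [P|/existsNP[j Pj]] := pselect (forall j, posdefmx (hermmx_of (tnth t j))); last first.
  rewrite [X in X * _](_ : _ = 0) ?mul0r//; apply/eqP/prodf_eq0.
  by exists j => //; rewrite (mgammaf0 _ Pj).
have [Q|Q] := pselect (posdefmx (hermmx_of (remainder (t, S)))); last first.
  by rewrite (mgammaf0 _ Q) mulr0.
exfalso; apply: nS; move: Q; rewrite hermmx_of_remainder/=.
(* Generalising over [M] lets the summands be added back one at a time. *)
move: (hermmx_of S) => M; elim/big_ind: _ M => [M|A B hA hB M|j _ M].
- by rewrite subr0.
- by rewrite opprD addrA => /hB /hA.
- by move=> /posdefmxD /(_ (P j)); rewrite subrK.
Qed.

Definition tcongr (L : 'M[C]_p) (t : k.-tuple (hermcoord R p)) :=
  [tuple hcongr L (tnth t j) | j < k].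

(** Homogeneity: when each X_j is replaced by its congruence by L, the remainder for S becomes the
    congruence of Y = I - sum_j X_j. Each determinant gains |det L|^2 = |det S|, and the traces of
    the pieces add up to tr S. *)
Lemma shifted_integrand_tcongr S L t : L \in unitmx ->
  hermmx_of S = L *m adjmx L -> posdefmx (hermmx_of S) ->
  shifted_integrand (tcongr L t, S) * (\prod_(j < k) (absdet L ^+ (p + p)))%:C =
  mgammaf s (hermmx_of S) * dirichlet_kernel t.
Proof.
move=> uL SL PS; rewrite /shifted_integrand /gamma_integrand /dirichlet_kernel /=.
have l0 : 0 < absdet L by apply: absdet_gt0; rewrite -unitfE -unitmxE.
have l2 : 0 < absdet L ^+ 2 by rewrite exprn_gt0.
set X := fun j => hermmx_of (tnth t j); set Y := 1%:M - \sum_j X j.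
have XE j : hermmx_of (tnth (tcongr L t) j) = L *m X j *m adjmx L.
  by rewrite tnth_mktuple hermmx_of_hcongr.
have YE : hermmx_of (remainder (tcongr L t, S)) = L *m Y *m adjmx L.
  rewrite hermmx_of_remainder SL /= /Y mulmxBr mulmxBl mulmx1; congr (_ - _).
  by rewrite mulmx_sumr mulmx_suml; apply: eq_bigr => j _; exact: XE.
rewrite YE.
case: asboolP => [[PX PY]|N]; last first.
  have [Q|/existsNP[j Pj]] := pselect (forall j, posdefmx (X j)); last first.
    have Nj : ~ posdefmx (L *m X j *m adjmx L) by move/(posdefmx_congrE _ uL).
    have Z : \prod_i mgammaf (a i) (hermmx_of (tnth (tcongr L t) i)) = 0.
      apply/eqP/prodf_eq0; exists j; first exact: isT.
      by rewrite XE (mgammaf0 _ Nj) eqxx.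
    rewrite Z !mul0r mulr0; exact: erefl.
  have NY : ~ posdefmx (L *m Y *m adjmx L).
    by move/(posdefmx_congrE _ uL) => PY; apply: N.
  rewrite (mgammaf0 _ NY) mulr0 mul0r mulr0; exact: erefl.
have aE M : absdet (L *m M *m adjmx L) = absdet L ^+ 2 * absdet M.
  by rewrite !absdetM absdet_adj expr2 mulrAC.
have aS : absdet (hermmx_of S) = absdet L ^+ 2.
  by rewrite SL absdetM absdet_adj expr2.
have trE : Re (\tr (hermmx_of S)) =
    \sum_j Re (\tr (L *m X j *m adjmx L)) + Re (\tr (L *m Y *m adjmx L)).
  rewrite -raddf_sum -raddfD -raddf_sum -raddfD; congr (Re (\tr _)).
  rewrite -mulmx_suml -mulmx_sumr -mulmxDl -mulmxDr SL; congr (_ *m _).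
  by rewrite /Y addrC subrK mulmx1.
have PLX j := posdefmx_congr uL (PX j).
have PLY := posdefmx_congr uL PY.
have dX j := absdet_gt0 (posdefmx_det (PX j)).
have dY := absdet_gt0 (posdefmx_det PY).
rewrite (mgammaf_pos _ PLY) (mgammaf_pos _ PS) aE (rpowCM _ l2 dY).
have GX j : mgammaf (a j) (L *m X j *m adjmx L) =
    rpowC (absdet L ^+ 2) (a j - p%:R) * rpowC (absdet (X j)) (a j - p%:R) *
    (expR (- Re (\tr (L *m X j *m adjmx L))))%:C.
  by rewrite (mgammaf_pos _ (PLX j)) aE (rpowCM _ l2 (dX j)).
under eq_bigr do rewrite XE GX.
rewrite aS trE opprD expRD -sumrN expR_sum.
rewrite !big_split/= rmorphM rmorph_prod/=.
(* Exponents of |det L|^2: the a_j - p and b - p add up to s - (k+1)p, and the k factors |det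
   L|^(2p) bring this to s - p. *)
have -> : rpowC (absdet L ^+ 2) (s - p%:R) =
   (\prod_j rpowC (absdet L ^+ 2) (a j - p%:R)) * rpowC (absdet L ^+ 2) (b - p%:R) *
   (\prod_(j < k) (absdet L ^+ (p + p)))%:C.
  rewrite !prodr_const card_ord addnn -mul2n exprM -exprM -rpowC_nat// mulrAC.
  have -> : \prod_j rpowC (absdet L ^+ 2) (a j - p%:R) =
      rpowC (absdet L ^+ 2) (\sum_j (a j - p%:R)).
    by elim/big_rec2: _ => [|j x y _ ->]; rewrite ?rpowC0 ?rpowCD.
  by rewrite -!rpowCD sumrB sumr_const card_ord natrM mulr_natr subrK addrA.
have -> : \prod_(j < k) rpowC (absdet (hermmx_of (tnth t j))) (a j - p%:R) =
  \prod_(j < k) rpowC (absdet (X j)) (a j - p%:R) by exact: erefl.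
by rewrite !rmorph_prod; ring.
Qed.

Lemma cmeas_dirichlet_kernel : cmeas dirichlet_kernel.
Proof.
have mX j : mxmeas (fun t : k.-tuple (hermcoord R p) => hermmx_of (tnth t j)).
  exact: mxmeas_tnth.
have mY : mxmeas (fun t : k.-tuple (hermcoord R p) =>
    1%:M - \sum_j hermmx_of (tnth t j)).
  by apply: mxmeasB; [exact: mxmeas_cst|exact: mxmeas_sum].
(* I - sum_j X_j is the remainder for S = I; it is thus of the form [hermmx_of], as
   [measurable_posdef_comp] requires. *)
have YE (t : k.-tuple (hermcoord R p)) : 1%:M - \sum_j hermmx_of (tnth t j) =
    hermmx_of (remainder (t, hcoord 1%:M)).
  by rewrite hermmx_of_remainder hcoordK ?adjmx1.
have mr : measurable_fun setT (fun t => remainder (t, hcoord 1%:M)).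
  exact: (measurableT_comp measurable_remainder (pair2_measurable _)).
apply: cmeas_if; last first.
  apply: cmeasM; last exact/cmeas_rpowC/measurable_absdet.
  by apply: cmeas_prod => j; exact/cmeas_rpowC/measurable_absdet.
rewrite [X in measurable X](_ : _ = (\bigcap_(j in [set: 'I_k])
      [set t | posdefmx (hermmx_of (tnth t j))]) `&`
    [set t | posdefmx (hermmx_of (remainder (t, hcoord 1%:M)))]).
  apply: measurableI; last exact: measurable_posdef_comp.
  apply: fin_bigcap_measurable => // j _.
  by apply: measurable_posdef_comp; exact: measurable_tnth.
apply/seteqP; split => t /= [P Q]; split.
- by move=> j _; exact: P.
- by rewrite -YE.
- by move=> j; exact: P.
- by rewrite YE.
Qed.

Lemma cov_tcongr S : posdefmx (hermmx_of S) -> exists L,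
  [/\ L \in unitmx, hermmx_of S = L *m adjmx L &
    cov mk mk (tcongr L) (fun=> \prod_(j < k) (absdet L ^+ (p + p)))].
Proof.
move=> PS; have [L [uL SL _ HL]] := cholesky_cov PS.
by exists L; split => //; exact: (cov_tuple (fun _ : 'I_k => HL)).
Qed.

(** An identity in the extended reals, hence available before the kernel is known to be
    integrable. *)
Lemma integral_normc_shifted S :
  (\int[mk]_t (normc (shifted_integrand (t, S)))%:E =
   (normc (mgammaf s (hermmx_of S)))%:E *
   \int[mk]_t (normc (dirichlet_kernel t))%:E)%E.
Proof.
have [PS|nPS] := pselect (posdefmx (hermmx_of S)); last first.
  rewrite /mgammaf asboolF// Normc.normc0 mul0e integral0_eq// => t _.
  by rewrite shifted_integrand_notpos// Normc.normc0.
have [L [uL SL [mt _ w0 H]]] := cov_tcongr PS.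
have m1 : measurable_fun setT (fun t => (normc (shifted_integrand (t, S)))%:E).
  apply/measurable_EFinP; apply: measurable_normc.
  exact: (cmeas_comp cmeas_shifted_integrand (pair2_measurable S)).
rewrite H//; last by move=> t; rewrite lee_fin normc_ge0.
rewrite -ge0_integralZl//.
- apply: eq_integral => t _.
  rewrite -!EFinM -Normc.normcM -(shifted_integrand_tcongr t uL SL PS).
  by rewrite [in RHS]Normc.normcM normc_real ger0_norm ?(w0 t).
- by apply/measurable_EFinP; apply: measurable_normc; exact: cmeas_dirichlet_kernel.
- by move=> t _; rewrite lee_fin normc_ge0.
- by rewrite lee_fin normc_ge0.
Qed.

(** By Tonelli, A M is the integral of the modulus of [shifted_integrand], hence finite. A = 0 would
    force [mxgamma p s] to vanish, so A > 0 and M is finite. *)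
Lemma cintegrable_dirichlet_kernel : cintegrable mk setT dirichlet_kernel.
Proof.
apply/cintegrableP; split; first exact: cmeas_dirichlet_kernel.
have [/cintegrableP[mH iH] _] := shifted_integrand_integral.
have [Is Es] := mgammaf_integral ps.
have /cintegrableP[ms fs] := Is.
set M := (\int[_]_t _)%E.
have M0 : (0 <= M)%E by apply: integral_ge0 => t _; rewrite lee_fin normc_ge0.
set A := (\int[_]_x _)%E in fs.
have A0 : (0 <= A)%E by apply: integral_ge0 => t _; rewrite lee_fin normc_ge0.
have AM : (A * M < +oo)%E.
  rewrite /A -ge0_integralZr//.
  - apply: le_lt_trans iH; rewrite sprod_integral2.
    + by rewrite le_eqVlt; apply/orP; left; apply/eqP/eq_integral => S _;
        exact: esym (integral_normc_shifted S).
    + by apply/measurable_EFinP; exact: measurable_normc.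
    + by move=> z; rewrite lee_fin normc_ge0.
  - by apply/measurable_EFinP; exact: measurable_normc.
  - by move=> c _; rewrite lee_fin normc_ge0.
rewrite ltey; apply/eqP => Moo; move: AM; rewrite Moo.
have Apos : (0 < A)%E.
  rewrite lt_def A0 andbT; apply/eqP => A00.
  have := mxgamma_neq0 ps; rewrite -Es cintegral_eq0 ?eqxx//.
by rewrite gt0_muley// ltxx.
Qed.

Lemma dirichlet_integral :
  mxgamma p s * cintegral mk setT dirichlet_kernel =
  (\prod_j mxgamma p (a j)) * mxgamma p b.
Proof.
have [IH <-] := shifted_integrand_integral.
have [Is <-] := mgammaf_integral ps.
have IK := cintegrable_dirichlet_kernel.
(* Stated for every S, both sides vanishing when S is not positive definite, because [cfubini] asks
   for integrable sections at every point. *)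
have inner S :
    cintegrable mk setT (fun t => shifted_integrand (t, S)) /\
    cintegral mk setT (fun t => shifted_integrand (t, S)) =
    cintegral mk setT dirichlet_kernel * mgammaf s (hermmx_of S).
  have [PS|nPS] := pselect (posdefmx (hermmx_of S)); last first.
    have -> : (fun t => shifted_integrand (t, S)) = (fun t => 0 * dirichlet_kernel t).
      by apply/funext => t; rewrite mul0r shifted_integrand_notpos.
    split; first exact: cintegrableZ.
    by rewrite cintegralZ// mul0r /mgammaf asboolF// mulr0.
  have [L [uL SL H]] := cov_tcongr PS.
  have m1 := cmeas_comp cmeas_shifted_integrand (pair2_measurable S).
  have X : (fun t => shifted_integrand (tcongr L t, S) *
      (\prod_(j < k) (absdet L ^+ (p + p)))%:C) =
      (fun t => mgammaf s (hermmx_of S) * dirichlet_kernel t).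
    by apply/funext => t; exact: shifted_integrand_tcongr.
  split; first by apply/(cov_cintegrable H m1); rewrite X; exact: cintegrableZ.
  by rewrite (cov_cintegral H m1) X cintegralZ// mulrC.
have sw := @cov_swap R _ _ _ _ mk (hleb p).
have X : (fun z : hermcoord R p * k.-tuple (hermcoord R p) =>
      shifted_integrand (z.2, z.1) * (cst 1 z)%:C) =
    (fun z => shifted_integrand (z.2, z.1)).
  by apply/funext => z; rewrite mulr1.
rewrite (cov_cintegral sw cmeas_shifted_integrand) X.
have /(cov_cintegrable sw cmeas_shifted_integrand) := IH; rewrite X => IH'.
have [|_ ->] := cfubini IH'; first by move=> S; exact: (inner S).1.
rewrite mulrC -cintegralZ//; apply: eq_cintegral => S.
exact: esym (inner S).2.
Qed.

End dirichlet_integral.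

(** * From the Dirichlet integral to the average *)

Section dirichlet_average.
Context {R : realType}.
Local Notation C := R[i].
Local Open Scope complex_scope.

(** I - X_i is I - sum_j X_j plus the X_j with j != i, a sum of positive definite matrices. *)
Lemma dirichlet_domainP p k (X : 'I_k -> 'M[C]_p) :
  dirichlet_domain X <->
  (forall j, posdefmx (X j)) /\ posdefmx (1%:M - \sum_j X j).
Proof.
split=> [[PX _ PY]|[PX PY]]; [exact: conj|split; [exact: PX|move=> i|exact: PY]].
have -> : 1%:M - X i = (1%:M - \sum_j X j) + \sum_(j | j != i) X j.
  by rewrite [in RHS](bigD1 i)//= opprD addrA subrK.
move: PY; move: (1%:M - _) => M; elim/big_ind: _ M => [M|A B hA hB M|j _ M].
- by rewrite addr0.
- by rewrite addrA => /hA /hB.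
- by move=> PM; exact: posdefmxD.
Qed.

(** The exponents gamma_j and alpha_j - p of |det X_j| add up: averaging phi_1 shifts the parameters
    of the kernel, while the normalising constant stays that of alpha. *)
Lemma dirichlet_integrandE p k (alpha : 'I_k.+1 -> C) (gamma : 'I_k -> C)
    (t : k.-tuple (hermcoord R p)) :
  dirichlet_integrand alpha (@det_power_product R p k gamma) t =
  dirichlet_const p alpha *
  dirichlet_kernel (fun j => alpha (widen_ord (leqnSn k) j) + gamma j)
    (alpha ord_max) t.
Proof.
rewrite /dirichlet_integrand /dirichlet_density /dirichlet_kernel.
rewrite (asbool_equiv_eq (dirichlet_domainP _)).
case: asboolP => _; last by rewrite !mulr0.
rewrite mulrCA -mulrA; congr (_ * _); rewrite mulrA; congr (_ * _).
rewrite /det_power_product -big_split/=; apply: eq_bigr => j _.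
by rewrite -rpowCD; congr (rpowC _ _); ring.
Qed.

End dirichlet_average.

Local Open Scope complex_scope.

Theorem mainTheorem1 (R : realType) (p k : nat) (hp : (1 <= p)%N)
    (hk : (1 <= k)%N) (alpha : 'I_k.+1 -> R[i]) (gamma : 'I_k -> R[i])
    (halpha : forall j : 'I_k.+1, p%:R - 1 < complex.Re (alpha j))
    (hgamma : forall j : 'I_k,
       p%:R - 1 < complex.Re (alpha (widen_ord (leqnSn k) j) + gamma j)) :
  dirichlet_average_exists alpha (@det_power_product R p k gamma) /\
  dirichlet_average alpha (@det_power_product R p k gamma) =
    (\prod_(j < k) (mxgamma p (alpha (widen_ord (leqnSn k) j) + gamma j)
                    / mxgamma p (alpha (widen_ord (leqnSn k) j)))) *
    (mxgamma p (\sum_(j < k.+1) alpha j)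
     / mxgamma p (\sum_(j < k) (alpha (widen_ord (leqnSn k) j) + gamma j)
                  + alpha ord_max)).
Proof.
set a := fun j : 'I_k => alpha (widen_ord (leqnSn k) j) + gamma j.
have pb := halpha ord_max.
(* Each Re a_j exceeds p - 1 >= 0, so the real part of the sum is at least that of alpha_(k+1). *)
have ps : p%:R - 1 < complex.Re (\sum_j a j + alpha ord_max).
  rewrite raddfD/= raddf_sum; apply: lt_le_trans pb _; rewrite lerDr.
  apply: sumr_ge0 => j _; apply: ltW; apply: le_lt_trans (hgamma j).
  by rewrite subr_ge0 ler1n.
have IK := cintegrable_dirichlet_kernel hgamma pb ps.
have EK := dirichlet_integral hgamma pb ps.
have E : dirichlet_integrand alpha (@det_power_product R p k gamma) =
    (fun t => dirichlet_const p alpha * dirichlet_kernel a (alpha ord_max) t).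
  by apply/funext => t; exact: dirichlet_integrandE.
rewrite /dirichlet_average_exists /dirichlet_average E.
split; first exact: cintegrableZ.
rewrite [LHS](cintegralZ _ IK) /dirichlet_const.
have nb := mxgamma_neq0 pb; have ns := mxgamma_neq0 ps.
(* [dirichlet_integral] solved for the integral, dividing by the gamma factor of the total
   parameter. *)
have -> : cintegral (hermcoord_measure R p k) setT (dirichlet_kernel a (alpha ord_max)) =
    ((\prod_j mxgamma p (a j)) * mxgamma p (alpha ord_max)) /
    mxgamma p (\sum_j a j + alpha ord_max).
  by rewrite -EK mulrC mulKf.
have -> : \prod_j mxgamma p (alpha j) =
    (\prod_(j < k) mxgamma p (alpha (widen_ord (leqnSn k) j))) *
    mxgamma p (alpha ord_max) by exact: big_ord_recr.
(* The gamma factor of alpha_(k+1) is in the denominator of the constant and in the numerator of the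
   integral, and cancels. *)
rewrite prodf_div; move: nb; move: (mxgamma p (alpha ord_max)) => G G0.
move: (mxgamma p (\sum_j alpha j)) (mxgamma p (\sum_j a j + _)) => Q S.
move: (\prod_j mxgamma p (alpha _)) (\prod_j mxgamma p (a j)) => P A.
rewrite invfM [LHS](_ : _ = (G^-1 * G) * (A / P * (Q / S))); last by ring.
by rewrite mulVf// mul1r.
Qed.
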